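(* Let $\mathcal{H}=\mathcal{H}(X)$ be a reproducing kernel Hilbert space, let $A,B,C,D,M,N\in\mathscr{B}(\mathcal{H})$, let $\sigma,\tau$ be symmetric means with corresponding interpolational paths $(\sigma_t)_{t\in[0,1]}$, $(\tau_t)_{t\in[0,1]}$, and let $\mu,\nu\in[0,1]$. If $f$ is a multiplicative Orlicz function and $\alpha,\beta\in[0,1]$, then $$ \begin{aligned} f\bigg(\mathrm{ber}\Big(\frac{A^*MB+C^*ND}{2}\Big)\bigg)\le{}&\frac12\Big(f\big(\mathrm{ber}(A^*MB)\big)\ \sigma_\mu\ \tfrac12\big\|f(B^*|M|^{2\alpha}B)+f(A^*|M^*|^{2(1-\alpha)}A)\big\|_{\mathrm{ber}}\Big)\\ &+\frac12\Big(f\big(\mathrm{ber}(C^*ND)\big)\ \tau_\nu\ \tfrac12\big\|f(D^*|N|^{2\beta}D)+f(C^*|N^*|^{2(1-\beta)}C)\big\|_{\mathrm{ber}}\Big). \end{aligned} $$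
   Context: Reproducing kernel Hilbert space: $X$ is a non-empty set and $\mathcal{H}=\mathcal{H}(X)$ is a Hilbert space of complex-valued functions on $X$ such that for every $x\in X$ the evaluation $\phi\mapsto\phi(x)$ is continuous on $\mathcal{H}$. For $x\in X$, $k_x\in\mathcal{H}$ is the unique element with $\phi(x)=\langle\phi,k_x\rangle$ for all $\phi\in\mathcal{H}$, and $\hat k_x=k_x/\|k_x\|$ is the normalized reproducing kernel (so it is implicit that $k_x\neq 0$ for all $x\in X$). $\mathscr{B}(\mathcal{H})$ is the algebra of bounded linear operators on $\mathcal{H}$, and $|T|=(T^*T)^{1/2}$; powers of positive operators are defined by functional calculus, with $|T|^0=I$. For $T\in\mathscr{B}(\mathcal{H})$, the Berezin number is $\mathrm{ber}(T)=\sup_{x\in X}|\langle T\hat k_x,\hat k_x\rangle|$ and the Berezin norm is $\|T\|_{\mathrm{ber}}=\sup_{x,y\in X}|\langle T\hat k_x,\hat k_y\rangle|$. Mean: a function $\sigma:[0,\infty)\times[0,\infty)\to[0,\infty)$ such that (1) $\sigma(a,b)\ge0$; (2) $a\le\sigma(a,b)\le b$ if $a\le b$; (3) $\sigma$ is monotone increasing in both variables; (4) $\sigma(\alpha a,\alpha b)=\alpha\sigma(a,b)$ for all $\alpha>0$; (5) $\sigma$ is continuous in $a$ and $b$. It is symmetric if $\sigma(a,b)=\sigma(b,a)$. An interpolational path for a symmetric mean $\sigma$ is a family $(\sigma_t)_{t\in[0,1]}$ of means on $[0,\infty)\times[0,\infty)$ such that (i) $\sigma_0(a,b)=a$, $\sigma_1(a,b)=b$,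 $\sigma_{1/2}(a,b)=\sigma(a,b)$ for all $a,b\ge0$; (ii) $\sigma(\sigma_s(a,b),\sigma_t(a,b))=\sigma_{(s+t)/2}(a,b)$ for all $s,t\in[0,1]$; (iii) each $\sigma_t$ is increasing in each of its components. One writes $a\,\sigma_t\,b$ for $\sigma_t(a,b)$. Orlicz function: a continuous, convex, non-decreasing $f:[0,\infty)\to[0,\infty)$ with $f(0)=0$ and $f(u)\to\infty$ as $u\to\infty$; throughout, Orlicz functions are assumed non-degenerate, i.e. $f(u)>0$ for all $u>0$. Multiplicative means $f(ab)=f(a)f(b)$ for all $a,b\ge0$. For a positive operator $T$, $f(T)$ is defined by the continuous functional calculus. *)

(* Defs.v *)
From HB Require Import structures.
From mathcomp Require Import all_boot all_order all_algebra.
From mathcomp Require Import complex.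
From mathcomp Require Import all_classical all_reals all_analysis.

Set Implicit Arguments.
Unset Strict Implicit.
Unset Printing Implicit Defensive.

Import Order.TTheory GRing.Theory Num.Theory.
Import numFieldNormedType.Exports.
Import ComplexField.Normc.

Local Open Scope classical_set_scope.
Local Open Scope ring_scope.
Local Open Scope complex_scope.

(* A vector of the carrier is identified with the function on X that it
   represents through the injective linear map [rkhs_fun]; the Hilbert space
   structure is a complete normed module over R[i] whose norm comes from an
   inner product, linear on the left and conjugate-linear on the right. *)
Record rkhs (R : realType) (X : Type) := Rkhs {
  rkhs_sort :> completeNormedModType R[i];
  inner : {dot rkhs_sort for Num.Def.conjC};
  inner_norm : forall u : rkhs_sort, `|u| ^+ 2 = inner u u;
  rkhs_fun : {linear rkhs_sort -> (X -> R[i]^o)};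
  rkhs_fun_inj : injective rkhs_fun;
  rkhs_eval_continuous :
    forall x : X, continuous (fun u : rkhs_sort => rkhs_fun u x)
}.

Section RkhsOperators.
Variables (R : realType) (X : Type) (H : rkhs R X).
Implicit Types (T S : H -> H) (u v : H) (x y : X).

Local Notation "''[' u , v ]" := (inner H u v) : ring_scope.

Definition bounded_op T : Prop :=
  linear T /\ exists c : R, forall u, `|T u| <= c%:C * `|u|.

(* The description determines the vector uniquely; it exists by the Riesz
   representation theorem. *)
Definition rep_kernel x : H :=
  xget 0 [set k | forall u, rkhs_fun H u x = '[u, k]].

Definition normalized_rk x : H := `|rep_kernel x|^-1 *: rep_kernel x.

Definition berezin_number T : R :=
  sup (range (fun x => normc '[T (normalized_rk x), normalized_rk x])).

Definition berezin_norm T : R :=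
  sup (range (fun xy : X * X =>
    normc '[T (normalized_rk xy.1), normalized_rk xy.2])).

(* Again unique, and existing by Riesz when T is bounded. *)
Definition adjoint T : H -> H :=
  fun v => xget 0 [set w | forall u, '[T u, v] = '[u, w]].

Definition spectrum T : set R[i] :=
  [set l | ~ exists S, [/\ bounded_op S,
                           (forall u, S (T u - l *: u) = u)
                         & (forall u, T (S u) - l *: S u = u)]].

Definition poly_op (p : {poly R}) T : H -> H :=
  fun u => \sum_(i < size p) (p`_i)%:C *: iter i T u.

(* Continuous functional calculus of a self-adjoint operator, whose spectrum is
   real: f(T) is the limit in operator norm of p(T) when the real polynomial p
   tends to f uniformly on the spectrum. This determines f(T) when f is
   continuous on the spectrum. *)
Definition is_fun_calc (f : R -> R) T S : Prop :=
  forall e : R, 0 < e -> exists p : {poly R},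
    (forall t : R, spectrum T t%:C -> `|p.[t] - f t| <= e) /\
    (forall u, `|poly_op p T u - S u| <= e%:C * `|u|).

Definition fun_calc (f : R -> R) T : H -> H :=
  xget (fun=> 0) [set S | is_fun_calc f T S].

(* Since 0 `^ 0 = 1, the power with exponent 0 is the identity. *)
Definition op_pow T (r : R) : H -> H := fun_calc (fun t => t `^ r) T.

Definition op_abs T : H -> H := op_pow (adjoint T \o T) 2^-1.

End RkhsOperators.

Section MeansAndOrlicz.
Variable R : realType.

(* Functions on [0, +oo[ are represented by functions on R whose values at
   negative arguments are left unconstrained. *)
Record is_mean (s : R -> R -> R) : Prop := IsMean {
  mean_ge0 : forall a b, 0 <= a -> 0 <= b -> 0 <= s a b;
  mean_between : forall a b, 0 <= a -> a <= b -> a <= s a b <= b;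
  mean_incl : forall a a' b, 0 <= a -> a <= a' -> 0 <= b -> s a b <= s a' b;
  mean_incr : forall a b b', 0 <= a -> 0 <= b -> b <= b' -> s a b <= s a b';
  mean_homogeneous : forall c a b,
    0 < c -> 0 <= a -> 0 <= b -> s (c * a) (c * b) = c * s a b;
  mean_continuousl : forall b, 0 <= b ->
    {within `[0, +oo[, continuous (fun a => s a b)};
  mean_continuousr : forall a, 0 <= a ->
    {within `[0, +oo[, continuous (fun b => s a b)}
}.

Definition symmetric_mean (s : R -> R -> R) : Prop :=
  is_mean s /\ forall a b, 0 <= a -> 0 <= b -> s a b = s b a.

(* Only the values of the path at parameters in [0, 1] matter. *)
Record interpolational_path (s : R -> R -> R) (st : R -> R -> R -> R) : Prop :=
  InterpolationalPath {
  path_mean : forall t, 0 <= t <= 1 -> is_mean (st t);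
  path_at0 : forall a b, 0 <= a -> 0 <= b -> st 0 a b = a;
  path_at1 : forall a b, 0 <= a -> 0 <= b -> st 1 a b = b;
  path_athalf : forall a b, 0 <= a -> 0 <= b -> st 2^-1 a b = s a b;
  path_mid : forall t r a b, 0 <= t <= 1 -> 0 <= r <= 1 -> 0 <= a -> 0 <= b ->
    s (st t a b) (st r a b) = st ((t + r) / 2) a b;
  path_incl : forall t a a' b, 0 <= t <= 1 ->
    0 <= a -> a <= a' -> 0 <= b -> st t a b <= st t a' b;
  path_incr : forall t a b b', 0 <= t <= 1 ->
    0 <= a -> 0 <= b -> b <= b' -> st t a b <= st t a b'
}.

Record orlicz (f : R -> R) : Prop := Orlicz {
  orlicz_ge0 : forall u, 0 <= u -> 0 <= f u;
  orlicz_continuous : {within `[0, +oo[, continuous f};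
  orlicz_convex : convex_function (`[0, +oo[%classic : set R) f;
  orlicz_nondecreasing : forall u v, 0 <= u -> u <= v -> f u <= f v;
  orlicz_at0 : f 0 = 0;
  orlicz_cvgy : f u @[u --> +oo] --> +oo;
  orlicz_nondegenerate : forall u, 0 < u -> 0 < f u
}.

Definition multiplicative_fun (f : R -> R) : Prop :=
  forall a b, 0 <= a -> 0 <= b -> f (a * b) = f a * f b.

End MeansAndOrlicz.

(* Main.v *)
(* Everything reduces to the real inner product [Re <u, v>].

   Riesz representation gives adjoints and the invertibility of coercive
   operators. For T self-adjoint and a real polynomial p that is nonnegative on
   the spectrum, p(T) is positive, by factoring p - m over the complex numbers.
   Together with the Weierstrass theorem this provides the continuous functional
   calculus f(T), and p(T) <= f(T) whenever p <= f on the spectrum. Applied to a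
   supporting line of f at <T u, u> for a unit vector u, the last fact is
   Jensen's inequality f(<T u, u>) <= <f(T) u, u>.

   From the intertwining M |M| = |M^*| M one obtains the mixed Schwarz inequality
     2 |<M u, v>| <= <|M|^(2a) u, u> + <|M^*|^(2(1-a)) v, v>,
   which, at u = B k and v = A k with k a normalized kernel, combined with
   convexity and Jensen, bounds f (ber (A^* M B)) by half the Berezin norm of
   f (B^* |M|^(2a) B) + f (A^* |M^*|^(2(1-a)) A). A mean lies above the
   smaller of its two arguments, so f (ber (A^* M B)) is also at most the mean,
   and convexity of f handles the sum of the two terms. *)

Require Import Defs.
From HB Require Import structures.
From mathcomp Require Import all_boot all_order all_algebra.
From mathcomp Require Import complex.
From mathcomp Require Import all_classical all_reals all_analysis.
From mathcomp Require Import ring lra.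
Import Order.TTheory GRing.Theory Num.Theory.
Import numFieldNormedType.Exports.
Local Open Scope classical_set_scope.
Local Open Scope ring_scope.
Import ComplexField.Normc.

Set Implicit Arguments.
Unset Strict Implicit.
Unset Printing Implicit Defensive.

(** * The real inner product *)

Section RealStructure.
Local Open Scope complex_scope.
Variables (R : realType) (X : Type) (H : rkhs R X).
Implicit Types (u v w : H) (a b c : R) (z : R[i]).

(** The real part determines the whole inner product ([inner_rin]) and lives in the ordered field
    [R], where infima and order arguments are available. [nrm] likewise moves the norm from [R[i]]
    to [R]. *)
Definition rin u v : R := complex.Re (inner H u v).
Definition nrm u : R := complex.Re `|u|.

Lemma nrmE u : `|u| = (nrm u)%:C.
Proof. by rewrite /nrm RRe_real // ger0_real. Qed.

Lemma ReD z1 z2 : complex.Re (z1 + z2) = complex.Re z1 + complex.Re z2 :> R.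
Proof. by case: z1; case: z2. Qed.

Lemma ReZ a z : complex.Re (a%:C * z) = a * complex.Re z.
Proof. by case: z => x y /=; rewrite mul0r subr0. Qed.

Lemma normr_normc z : `|z| = (normc z)%:C.
Proof. by []. Qed.

Lemma normc_ge0 z : 0 <= normc z.
Proof. by case: z => a b; rewrite sqrtr_ge0. Qed.

Lemma nrm_ge0 u : 0 <= nrm u.
Proof. by rewrite -ler0c -nrmE. Qed.

Lemma nrm0 : nrm 0 = 0.
Proof. by rewrite /nrm normr0. Qed.

Lemma nrm0_eq0 u : nrm u = 0 -> u = 0.
Proof. by move=> u0; apply/normr0_eq0; rewrite nrmE u0. Qed.

Lemma nrmD u v : nrm (u + v) <= nrm u + nrm v.
Proof. by rewrite -lecR rmorphD /= -!nrmE ler_normD. Qed.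

Lemma nrmN u : nrm (- u) = nrm u.
Proof. by rewrite /nrm normrN. Qed.

Lemma nrmB u v : nrm (u - v) = nrm (v - u).
Proof. by rewrite -nrmN opprB. Qed.

Lemma nrmZ z u : nrm (z *: u) = normc z * nrm u.
Proof. by rewrite /nrm normrZ normr_normc ReZ. Qed.

Lemma normcR a : normc a%:C = `|a|.
Proof. by rewrite /= expr0n addr0 sqrtr_sqr. Qed.

Lemma rin_sq u : rin u u = nrm u ^+ 2.
Proof.
by rewrite /rin -inner_norm nrmE -rmorphXn.
Qed.

Lemma innerC u v : inner H u v = conjc (inner H v u).
Proof. by rewrite (hermC (inner H) u v) /= expr0 mul1r. Qed.

Lemma rinC u v : rin u v = rin v u.
Proof. by rewrite /rin innerC; case: (inner H v u). Qed.

Lemma rinDl u v w : rin (u + v) w = rin u w + rin v w.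
Proof. by rewrite /rin linearDl ReD. Qed.

Lemma rinDr u v w : rin w (u + v) = rin w u + rin w v.
Proof. by rewrite !(rinC w) rinDl. Qed.

Lemma rinZl a u w : rin (a%:C *: u) w = a * rin u w.
Proof. by rewrite /rin linearZl_LR /= ReZ. Qed.

Lemma rinZr a u w : rin w (a%:C *: u) = a * rin w u.
Proof. by rewrite !(rinC w) rinZl. Qed.

Lemma rinNl u w : rin (- u) w = - rin u w.
Proof. by rewrite -scaleN1r -[-1](rmorphN1 (real_complex R)) rinZl mulN1r. Qed.

Lemma rinNr u w : rin w (- u) = - rin w u.
Proof. by rewrite !(rinC w) rinNl. Qed.

Lemma rin0l w : rin 0 w = 0.
Proof. by rewrite /rin linear0l. Qed.

Definition rinE := (rinDl, rinDr, rinZl, rinZr, rinNl, rinNr).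

(** The form is conjugate-linear on the right, so the real part of [<u, i v>] is the imaginary part
    of [<u, v>]. *)
Lemma inner_rin u v : inner H u v = rin u v +i* rin u ('i *: v).
Proof.
rewrite /rin linearZr_LR /=; case: (inner H u v) => x y /=.
by congr (_ +i* _); ring.
Qed.

(** Nonnegativity of [|u - t v|^2] at its minimiser [t = <u, v> / |v|^2]. *)
Lemma rin_cauchy u v : `|rin u v| <= nrm u * nrm v.
Proof.
have [v0|v0] := eqVneq (nrm v) 0.
  by rewrite (nrm0_eq0 v0) rinC rin0l normr0 mulr_ge0 ?nrm_ge0.
have vp : 0 < nrm v by rewrite lt_def v0 nrm_ge0.
set t := rin u v / nrm v ^+ 2.
have : 0 <= rin (u - t%:C *: v) (u - t%:C *: v) by rewrite rin_sq sqr_ge0.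
rewrite !rinE (rinC v u) !rin_sq => h.
have : rin u v ^+ 2 <= (nrm u * nrm v) ^+ 2.
  have -> : rin u v = t * nrm v ^+ 2 by rewrite /t divfK // sqrf_eq0.
  move: h; have -> : rin u v = t * nrm v ^+ 2 by rewrite /t divfK // sqrf_eq0.
  move=> h; rewrite -subr_ge0.
  have -> : (nrm u * nrm v) ^+ 2 - (t * nrm v ^+ 2) ^+ 2 =
   (nrm v ^+ 2) * (nrm u ^+ 2 + - (t * (t * nrm v ^+ 2)) + (- (t * (t * nrm v ^+ 2)) -
     - (t * (t * nrm v ^+ 2)))) by ring.
  by rewrite mulr_ge0 // ?sqr_ge0 //; lra.
rewrite -real_normK ?num_real // ler_sqr ?nnegrE //.
by rewrite mulr_ge0 ?nrm_ge0.
Qed.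

(** [z] is the conjugate phase of [<u, v>], or 1 when that vanishes. Bounds on moduli thus reduce to
    bounds on [rin]. *)
Lemma inner_phase u v : exists z, normc z = 1 /\
  normc (inner H u v) = rin (z *: u) v.
Proof.
set s := inner H u v; have [s0|s0] := eqVneq s 0.
  exists 1; rewrite normc1; split => //.
  by rewrite scale1r /rin -/s s0 normc0.
exists (conjc s / `|s|).
have ns : `|s| != 0 by rewrite normr_eq0.
split.
  have : (normc (conjc s / `|s|))%:C = 1%:C.
    by rewrite -normr_normc normrM normfV normcJ normr_id divff.
  by case.
rewrite /rin linearZl_LR /= -/s mulrAC [_ * s]mulrC.
have : s * conjc s / `|s| = (normc s)%:C.
  by rewrite -sqr_normc expr2 mulfK // normr_normc.
by move=> ->.
Qed.

Lemma normc_inner u v :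
  normc (inner H u v) <= nrm u * nrm v.
Proof.
have [z [z1 ->]] := inner_phase u v.
apply: (le_trans (ler_norm _)); apply: (le_trans (rin_cauchy _ _)).
by rewrite nrmZ z1 mul1r.
Qed.

Lemma hilbert_complete (x : nat -> H) :
  (forall e, 0 < e -> exists N, forall m n, (N <= m)%N -> (N <= n)%N ->
    nrm (x m - x n) <= e) ->
  exists l, forall e, 0 < e -> exists N, forall n, (N <= n)%N ->
    nrm (x n - l) <= e.
Proof.
move=> cx.
have /cauchy_cvgP cv : cauchy (x @ \oo).
  apply: cauchy_exP => e e0.
  (* Positive elements of [R[i]] are real, so [e] is the image of its real part. *)
  have [er e0r] : e \is Num.real /\ 0 < complex.Re e.
    split; first exact: gtr0_real.
    by move: e0; rewrite ltcE => /andP[].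
  have [N hN] := cx (complex.Re e / 2) (divr_gt0 e0r (ltr0Sn _ _)).
  exists (x N); exists N => // n /= Nn.
  rewrite -ball_normE /ball_ /= nrmE -(RRe_real er) ltcR.
  by apply: le_lt_trans (hN _ _ (leqnn N) Nn) _; lra.
exists (lim (x @ \oo)) => e e0.
have ec : 0 < e%:C :> R[i] by rewrite ltcR.
have /cvgrPdist_le /(_ _ ec) [N _ hN] := cv.
exists N => n /hN /=; rewrite nrmE lecR.
by rewrite nrmB.
Qed.

End RealStructure.

(** * Riesz representation and adjoints *)

(** At [t = - b / (a + 1)] the quadratic equals [- (b / (a + 1))^2 (a + 2)]. Dividing by [a + 1]
    instead of [a] also covers [a = 0]. *)
Lemma quad_ge0_lin0 (R : realType) (a b : R) :
  0 <= a -> (forall t, 0 <= t ^+ 2 * a + 2 * t * b) -> b = 0.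
Proof.
move=> a0 h; have a1 : 0 < a + 1 by lra.
have := h (- b / (a + 1)).
have -> : (- b / (a + 1)) ^+ 2 * a + 2 * (- b / (a + 1)) * b =
  - ((b / (a + 1)) ^+ 2 * (a + 2)) by field; rewrite gt_eqF.
rewrite oppr_ge0 pmulr_lle0; last by lra.
move=> h2; have : (b / (a + 1)) ^+ 2 == 0 by rewrite eq_le h2 sqr_ge0.
by rewrite sqrf_eq0 mulf_eq0 invr_eq0 (gt_eqF a1) orbF => /eqP.
Qed.

Lemma archi_inv (R : realType) (e : R) : 0 < e ->
  exists N, forall n, (N <= n)%N -> n.+1%:R^-1 <= e.
Proof.
move=> e0; exists (Num.bound e^-1) => n Nn.
have e1 : 0 <= e^-1 by rewrite invr_ge0 ltW.
rewrite invf_ple ?posrE // ltW // (lt_le_trans (archi_boundP e1)) //.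
by rewrite ler_nat ltnW.
Qed.

Section BoundedOperators.
Local Open Scope complex_scope.
Variables (R : realType) (X : Type) (H : rkhs R X).
Implicit Types (T S P : H -> H) (u v w : H) (a b c : R) (z : R[i]).

Definition selfadj T := forall u v, rin (T u) v = rin u (T v).

Section Linear.
Variables (T : H -> H) (lT : linear T).

Lemma lin0 : T 0 = 0.
Proof. by have := lT (-1) 0 0; rewrite scaler0 add0r scaleN1r addNr. Qed.

Lemma linD u v : T (u + v) = T u + T v.
Proof. by have := lT 1 u v; rewrite !scale1r. Qed.

Lemma linZ z u : T (z *: u) = z *: T u.
Proof. by have := lT z u 0; rewrite lin0 !addr0. Qed.

Lemma linN u : T (- u) = - T u.
Proof. by rewrite -scaleN1r linZ scaleN1r. Qed.

Lemma linB u v : T (u - v) = T u - T v.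
Proof. by rewrite linD linN. Qed.

End Linear.

Lemma bounded_opP T : bounded_op T <->
  linear T /\ exists c, 0 < c /\ forall u, nrm (T u) <= c * nrm u.
Proof.
split=> -[lT [c hc]]; split=> //.
  exists (`|c| + 1); split; first by rewrite ltr_wpDl.
  move=> u; have := hc u; rewrite !nrmE -rmorphM /= lecR => /le_trans; apply.
  by rewrite ler_wpM2r ?nrm_ge0 // (le_trans (ler_norm _)) // lerDl.
by exists c => u; rewrite !nrmE -rmorphM /= lecR; case: hc.
Qed.

Lemma bounded_op_comp T S : bounded_op T -> bounded_op S -> bounded_op (T \o S).
Proof.
move=> /bounded_opP[lT [c [c0 hc]]] /bounded_opP[lS [d [d0 hd]]].
apply/bounded_opP; split=> [a u v|]; first by rewrite /= lS lT.
exists (c * d); split=> [|u /=]; first exact: mulr_gt0.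
by apply: le_trans (hc _) _; rewrite -mulrA ler_pM2l.
Qed.

Lemma bounded_op_add T S : bounded_op T -> bounded_op S ->
  bounded_op (fun u => T u + S u).
Proof.
move=> /bounded_opP[lT [c [c0 hc]]] /bounded_opP[lS [d [d0 hd]]].
apply/bounded_opP; split=> [a u v|]; first by rewrite lS lT scalerDr addrACA.
exists (c + d); split=> [|u /=]; first exact: addr_gt0.
by apply: le_trans (nrmD _ _) _; rewrite mulrDl lerD.
Qed.

Lemma bounded_op_scale z T : bounded_op T -> bounded_op (fun u => z *: T u).
Proof.
move=> /bounded_opP[lT [c [c0 hc]]].
apply/bounded_opP; split=> [a u v|].
  by rewrite lT scalerDr !scalerA mulrC.
have z0 := normc_ge0 z.
exists ((normc z + 1) * c); split=> [|u /=].
  by rewrite mulr_gt0 // ltr_wpDl.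
rewrite nrmZ -mulrA ler_pM ?nrm_ge0 // lerDl //.
Qed.

Lemma bounded_op_id : bounded_op (fun u : H => u).
Proof.
by apply/bounded_opP; split=> //; exists 1; split=> // u; rewrite mul1r.
Qed.

Lemma bounded_op_subZ z T : bounded_op T -> bounded_op (fun u => T u - z *: u).
Proof.
move=> bT; rewrite (_ : (fun u => _) = fun u => T u + (- z) *: u).
  by apply: bounded_op_add => //; exact/bounded_op_scale/bounded_op_id.
by apply/funext => u; rewrite scaleNr.
Qed.

(* The vector [w] minimises [rin (P u) u - 2 * phi u]. *)
Lemma coercive_riesz P c (phi : H -> R) K :
  bounded_op P -> selfadj P -> 0 < c ->
  (forall u, c * nrm u ^+ 2 <= rin (P u) u) ->
  (forall a u v, phi (a%:C *: u + v) = a * phi u + phi v) ->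
  (forall u, `|phi u| <= K * nrm u) ->
  exists w, forall u, phi u = rin u (P w).
Proof.
move=> bP sP c0 cP lphi bphi.
have [lP _] := bP.
have phi0 : phi 0 = 0.
  by have := lphi (-1) 0 0; rewrite scaler0 addr0 mulN1r addNr.
have phiZ a u : phi (a%:C *: u) = a * phi u.
  by rewrite -[_ *: _]addr0 lphi phi0 addr0.
have phiD u v : phi (u + v) = phi u + phi v.
  by have := lphi 1 u v; rewrite scale1r mul1r.
have rinP u v : rin (P u) v = rin (P v) u by rewrite sP rinC.
have Pge0 u : 0 <= rin (P u) u.
  by apply: le_trans (cP u); rewrite mulr_ge0 ?sqr_ge0 ?ltW.
pose J u := rin (P u) u - 2 * phi u.
have JD u v t : J (u + t%:C *: v) =
    J u + t ^+ 2 * rin (P v) v + 2 * t * (rin (P u) v - phi v).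
  rewrite /J phiD phiZ linD // linZ // !rinE (rinP v u); ring.
(* Parallelogram identity for the form of [P]; it controls the distance between two almost minimal
   vectors. *)
have J2 u v : J u + J v - 2 * J (2^-1%:C *: (u + v)) =
    2^-1 * rin (P (u - v)) (u - v).
  rewrite /J phiZ phiD linZ // linB // linD // !rinE (rinP v u); by field.
have Jlb : has_inf (range J).
  split; first by exists (J 0), 0.
  (* The bound comes from completing the square in [c n^2 - 2 K n], with [n] the norm of [u]. *)
  exists (- (K ^+ 2 / c)) => _ [u _ <-].
  have h1 := cP u; have := ler_norm (phi u) => /le_trans /(_ (bphi u)) h2.
  apply: (@le_trans _ _ (c * nrm u ^+ 2 - 2 * (K * nrm u))); last first.
    by rewrite /J; lra.
  rewrite -subr_ge0 opprK.
  have -> : c * nrm u ^+ 2 - 2 * (K * nrm u) + K ^+ 2 / c =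
    (c * nrm u - K) ^+ 2 / c by field; rewrite gt_eqF.
  by rewrite divr_ge0 ?sqr_ge0 ?ltW.
set m := inf (range J).
have mJ u : m <= J u by apply: ge_inf; [case: Jlb|exists u].
have /choice [x hx] n : exists u, J u <= m + n.+1%:R^-1.
  have n0 : 0 < n.+1%:R^-1 :> R by rewrite invr_gt0.
  by have [_ [u _ <-] /ltW ?] := inf_adherent n0 Jlb; exists u.
have [|w hw] := @hilbert_complete _ _ _ x.
  move=> e e0.
  (* When both values of [J] are within [c e^2 / 4] of the infimum, [J2] and coercivity give
     [c |x p - x q|^2 <= c e^2]. *)
  have e1 : 0 < c / 4 * e ^+ 2 by rewrite !mulr_gt0 ?exprn_gt0 ?invr_gt0.
  have [N hN] := archi_inv e1; exists N => p q Np Nq.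
  rewrite -ler_sqr ?nnegrE ?nrm_ge0 ?(ltW e0) // -(ler_pM2l c0).
  apply: le_trans (cP _) _.
  have := J2 (x p) (x q); have := hx p; have := hx q.
  have := hN p Np; have := hN q Nq; have := mJ (2^-1%:C *: (x p + x q)).
  move: (J (2^-1%:C *: _)) (rin _ _) (p.+1%:R^-1) (q.+1%:R^-1) => j r p' q'.
  by lra.
have Jw : J w <= m.
  apply/ler_addgt0Pr => e e0.
  (* [L |d|] bounds the linear part of [J (w + d)] in the expansion [JD]; the summand 1 keeps [L]
     positive. *)
  pose L := 2 * nrm (P w) + 2 * `|K| + 1.
  have L0 : 0 < L.
    by have := nrm_ge0 (P w); have := normr_ge0 K; rewrite /L; lra.
  have e1 : 0 < e / 2 by lra.
  have e2 : 0 < e / 2 / L by rewrite divr_gt0.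
  have [N1 hN1] := archi_inv e1; have [N2 hN2] := hw _ e2.
  pose n := maxn N1 N2.
  have := hN1 n (leq_maxl _ _); have := hN2 n (leq_maxr _ _); have := hx n.
  set d := x n - w => h1 h2 h3.
  have := JD w d 1; rewrite /= scale1r subrKC => Jx.
  have := Pge0 d => Pd.
  have : `|rin (P w) d| <= nrm (P w) * nrm d by exact: rin_cauchy.
  have : `|phi d| <= `|K| * nrm d.
    by apply: le_trans (bphi d) _; rewrite ler_wpM2r ?nrm_ge0 ?ler_norm.
  rewrite !ler_norml => /andP[_ h4] /andP[h5 _].
  have h6 : L * nrm d <= e / 2 by rewrite -ler_pdivlMl // mulrC.
  have := nrm_ge0 d; rewrite /L in h6; rewrite /= in Jx.
  move: (n.+1%:R^-1) h1 h3 => n1 h1 h3; lra.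
exists w => v; apply/eqP; rewrite -subr_eq0 -oppr_eq0 opprB; apply/eqP.
(* First variation: [J (w + t v) - J w] is a nonnegative quadratic in [t] without constant term, so
   its linear coefficient vanishes. *)
apply: (@quad_ge0_lin0 _ (rin (P v) v)) => // t.
have := mJ (w + t%:C *: v); rewrite JD (rinC v); lra.
Qed.

Lemma riesz (phi : H -> R) K :
  (forall a u v, phi (a%:C *: u + v) = a * phi u + phi v) ->
  (forall u, `|phi u| <= K * nrm u) ->
  exists w, forall u, phi u = rin u w.
Proof.
move=> lphi bphi.
apply: (coercive_riesz bounded_op_id _ ltr01 _ lphi bphi) => // u.
by rewrite mul1r rin_sq.
Qed.

Definition invertible_op T := exists S,
  [/\ bounded_op S, (forall u, S (T u) = u) & (forall u, T (S u) = u)].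

(** Surjectivity is [coercive_riesz] applied to the functional [<., v>]. Coercivity with
    Cauchy-Schwarz gives [c |u| <= |P u|], hence injectivity and the bound [c^-1] on the inverse. *)
Lemma coercive_invertible P c : bounded_op P -> selfadj P -> 0 < c ->
  (forall u, c * nrm u ^+ 2 <= rin (P u) u) -> invertible_op P.
Proof.
move=> bP sP c0 cP; have [lP _] := bP.
have /choice [S hS] v : exists w, P w = v.
  have [||w hw] := @coercive_riesz P c (fun u => rin u v) (nrm v) bP sP c0 cP.
  - by move=> a u w; rewrite !rinE.
  - by move=> u; rewrite mulrC; exact: rin_cauchy.
  exists w; apply/eqP; rewrite -subr_eq0; apply/eqP/nrm0_eq0/eqP.
  by rewrite -sqrf_eq0 -rin_sq rinDr rinNr -hw rinC subrr.
have bP' u : c * nrm u <= nrm (P u).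
  have := nrm_ge0 u; rewrite le_eqVlt => /predU1P[<-|u0].
    by rewrite mulr0 nrm_ge0.
  rewrite -(ler_pM2r u0) -mulrA -expr2; apply: le_trans (cP u) _.
  by apply: le_trans (ler_norm _) (rin_cauchy _ _).
have iP u v : P u = P v -> u = v.
  move=> uv; apply/eqP; rewrite -subr_eq0; apply/eqP/nrm0_eq0/eqP.
  have := bP' (u - v); rewrite linB // uv subrr nrm0 pmulr_rle0 // => h.
  by rewrite eq_le h nrm_ge0.
exists S; split=> // [|u]; last by apply: iP; rewrite hS.
apply/bounded_opP; split=> [a u v|].
  by apply: iP; rewrite lP !hS.
exists c^-1; split=> [|u]; first by rewrite invr_gt0.
by rewrite -ler_pdivrMl ?invr_gt0 // invrK -{2}(hS u).
Qed.

Lemma rinJ u v : rin u ('i *: v) = - rin ('i *: u) v.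
Proof.
rewrite /rin linearZl_LR linearZr_LR /=.
case: (inner H u v) => x y /=; ring.
Qed.

(** The imaginary part is [rin] at [i v], and [S] commutes with [i], so the adjoint relation for
    real parts extends to the full inner product. *)
Lemma rin_inner T S : linear T -> linear S ->
  (forall u v, rin (T u) v = rin u (S v)) ->
  forall u v, inner H (T u) v = inner H u (S v).
Proof.
move=> lT lS h u v.
by rewrite !inner_rin !h linZ.
Qed.

Lemma rin_eq u v : (forall w, rin w u = rin w v) -> u = v.
Proof.
move=> h; apply/eqP; rewrite -subr_eq0; apply/eqP/nrm0_eq0/eqP.
by rewrite -sqrf_eq0 -rin_sq rinDr rinNr h subrr.
Qed.

Lemma adjoint_exists T : bounded_op T -> exists S, bounded_op S /\
  forall u v, rin (T u) v = rin u (S v).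
Proof.
move=> bT; have /bounded_opP[lT [c [c0 hc]]] := bT.
have /choice [S hS] v : exists w, forall u, rin (T u) v = rin u w.
  apply: (@riesz _ (c * nrm v)) => [a u w|u].
    by rewrite linD // linZ // !rinE.
  apply: le_trans (rin_cauchy _ _) _.
  by rewrite mulrAC ler_wpM2r ?nrm_ge0.
exists S; split=> [|u v]; last exact: hS.
apply/bounded_opP; split=> [z u v|].
  apply: rin_eq => w; rewrite -hS !rinDr -!hS; congr (_ + _).
  (* Complex homogeneity needs the full inner product; its imaginary part is transferred by moving
     [i] across with [rinJ]. *)
  rewrite /rin !linearZr_LR /= (_ : inner H (T w) u = inner H w (S u)) //.
  by rewrite !inner_rin -hS (rinJ w) -hS linZ // -rinJ.
exists c; split=> // v.
have := nrm_ge0 (S v); rewrite le_eqVlt => /predU1P[<-|v0].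
  by rewrite mulr_ge0 ?nrm_ge0 ?ltW.
rewrite -(ler_pM2r v0) -expr2 -rin_sq -hS.
apply: le_trans (le_trans (ler_norm _) (rin_cauchy _ _)) _.
by rewrite mulrAC ler_wpM2r ?nrm_ge0.
Qed.

(** [S v] meets the description chosen from by [adjoint], which rules out the default value 0;
    [rin_eq] then gives uniqueness. *)
Lemma adjoint_eq T S : linear T -> linear S ->
  (forall u v, rin (T u) v = rin u (S v)) -> adjoint T = S.
Proof.
move=> lT lS h; apply/funext => v; rewrite /adjoint.
case: xgetP => [w -> hw|/(_ (S v))[]]; last by move=> u; exact: rin_inner.
by apply: rin_eq => u; rewrite -h /rin hw.
Qed.

Lemma adjointP T : bounded_op T ->
  bounded_op (adjoint T) /\ forall u v, rin (T u) v = rin u (adjoint T v).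
Proof.
move=> bT; have [S [bS hS]] := adjoint_exists bT.
by rewrite (adjoint_eq _ _ hS) //; [case: bT|case: bS].
Qed.

Lemma adjointK T : bounded_op T -> adjoint (adjoint T) = T.
Proof.
move=> bT; have [bA hA] := adjointP bT.
apply: adjoint_eq => [||u v]; [by case: bA|by case: bT|].
by rewrite rinC -hA rinC.
Qed.

End BoundedOperators.

(** * Polynomials of operators and the spectrum *)

Section OperatorPolynomials.
Local Open Scope complex_scope.
Variables (R : realType) (X : Type) (H : rkhs R X).
Implicit Types (T S M : H -> H) (u v w : H) (z : R[i]) (p q : {poly R[i]}).

(** Complex coefficients, unlike in [poly_op], so that the polynomial splits into linear factors. *)
Definition cpoly_op p T u : H := \sum_(i < size p) p`_i *: iter i T u.

Lemma cpoly_op_widen n p T u : (size p <= n)%N ->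
  cpoly_op p T u = \sum_(i < n) p`_i *: iter i T u.
Proof.
move=> pn; rewrite /cpoly_op (big_ord_widen n (fun i => p`_i *: iter i T u)) //.
rewrite big_mkcond /=; apply: eq_bigr => i _.
by case: ltnP => // h; rewrite nth_default // scale0r.
Qed.

Lemma cpoly_opD p q T u : cpoly_op (p + q) T u = cpoly_op p T u + cpoly_op q T u.
Proof.
pose n := maxn (size p) (size q).
rewrite !(@cpoly_op_widen n) ?leq_maxl ?leq_maxr ?size_polyD //.
by rewrite -big_split; apply: eq_bigr => i _; rewrite coefD scalerDl.
Qed.

Lemma cpoly_opC z T u : cpoly_op z%:P T u = z *: u.
Proof.
rewrite (@cpoly_op_widen 1) ?size_polyC_leq1 //.
by rewrite big_ord1 coefC.
Qed.

Lemma cpoly_opZ z p T u : cpoly_op (z *: p) T u = z *: cpoly_op p T u.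
Proof.
rewrite (@cpoly_op_widen (size p)) ?size_scale_leq // scaler_sumr.
by apply: eq_bigr => i _; rewrite coefZ scalerA.
Qed.

Lemma cpoly_opMX p T u : cpoly_op (p * 'X) T u = cpoly_op p T (T u).
Proof.
rewrite (@cpoly_op_widen (size p).+1) ?size_polyMX_leq //; last first.
  by rewrite (leq_trans (size_polyMleq _ _)) // size_polyX addn2.
rewrite big_ord_recl coefMX /= scale0r add0r.
by apply: eq_bigr => i _; rewrite coefMX /= -iterSr.
Qed.

(** Taken with [M = T = S] it says that [T] commutes with its polynomials; with [M] between two
    different operators it transports the calculus of one to the other. *)
Lemma cpoly_op_intertwine p M T S : linear M -> (forall u, M (T u) = S (M u)) ->
  forall u, M (cpoly_op p T u) = cpoly_op p S (M u).
Proof.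
move=> lM h; elim/poly_ind: p => [|p z IH] u.
  by rewrite -(polyC0 R[i]) !cpoly_opC linZ.
by rewrite !cpoly_opD !cpoly_opMX !cpoly_opC linD // linZ // IH h.
Qed.

Lemma cpoly_opM p q T u : linear T ->
  cpoly_op (p * q) T u = cpoly_op p T (cpoly_op q T u).
Proof.
move=> lT; elim/poly_ind: p u => [|p z IH] u.
  by rewrite mul0r -(polyC0 R[i]) !cpoly_opC !scale0r.
rewrite mulrDl mul_polyC -mulrA -(commr_polyX q) mulrA.
rewrite !cpoly_opD !cpoly_opMX cpoly_opZ cpoly_opC IH.
by rewrite -(cpoly_op_intertwine _ lT (fun=> erefl)).
Qed.

Lemma cpoly_op_bounded p T : bounded_op T -> bounded_op (cpoly_op p T).
Proof.
move=> bT; elim/poly_ind: p => [|p z IH].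
  rewrite (_ : cpoly_op 0 T = fun u => 0 *: u).
    exact/bounded_op_scale/bounded_op_id.
  by apply/funext => u; rewrite -(polyC0 R[i]) cpoly_opC.
rewrite (_ : cpoly_op _ T = fun u => (cpoly_op p T \o T) u + z *: u).
  apply: bounded_op_add; first exact: bounded_op_comp.
  exact/bounded_op_scale/bounded_op_id.
by apply/funext => u; rewrite cpoly_opD cpoly_opMX cpoly_opC.
Qed.

Lemma cpoly_opXsubC z T u : cpoly_op ('X - z%:P) T u = T u - z *: u.
Proof.
rewrite -polyCN cpoly_opD cpoly_opC -['X]mul1r cpoly_opMX cpoly_opC.
by rewrite scale1r scaleNr.
Qed.

Lemma invertible_op_comp T S : invertible_op T -> invertible_op S ->
  invertible_op (T \o S).
Proof.
move=> [T' [bT' h1 h2]] [S' [bS' h3 h4]]; exists (S' \o T'); split.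
- exact: bounded_op_comp.
- by move=> u; rewrite /= h1 h3.
- by move=> u; rewrite /= h4 h2.
Qed.

Lemma invertible_op_scale z : z != 0 -> invertible_op (fun u : H => z *: u).
Proof.
move=> z0; exists (fun u => z^-1 *: u); split.
- exact/bounded_op_scale/bounded_op_id.
- by move=> u; rewrite scalerA mulVf // scale1r.
- by move=> u; rewrite scalerA divff // scale1r.
Qed.

(** Over the complex numbers [p(T)] is a nonzero scalar times a product of factors [T - z] with [z]
    a root, each invertible because [z] is off the spectrum. *)
Lemma cpoly_op_invertible p T : bounded_op T -> p != 0 ->
  (forall z, root p z -> ~ spectrum T z) -> invertible_op (cpoly_op p T).
Proof.
move=> [lT _] p0; have [r ->] := closed_field_poly_normal p => h.
have l0 : lead_coef p != 0 by rewrite lead_coef_eq0.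
have {}h z : z \in r -> ~ spectrum T z.
  move=> zr; apply: h; rewrite rootZ //.
  by rewrite root_prod_XsubC.
rewrite (_ : cpoly_op _ T = (fun u : H => lead_coef p *: u) \o
    cpoly_op (\prod_(z <- r) ('X - z%:P)) T); last first.
  by apply/funext => u; rewrite cpoly_opZ.
apply: invertible_op_comp; first exact: invertible_op_scale.
elim: r h => [|z r IH] h.
  rewrite (_ : cpoly_op _ T = fun u : H => 1 *: u).
    exact/invertible_op_scale/oner_neq0.
  by apply/funext => u; rewrite big_nil cpoly_opC.
rewrite (_ : cpoly_op _ T = (fun u => T u - z *: u) \o
    cpoly_op (\prod_(z <- r) ('X - z%:P)) T); last first.
  by apply/funext => u; rewrite big_cons cpoly_opM // cpoly_opXsubC.
apply: invertible_op_comp.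
  by apply: contrapT; have := h z (mem_head _ _).
by apply: IH => y yr; apply: h; rewrite in_cons yr orbT.
Qed.

Lemma invertible_op_factor T S Q : bounded_op T -> bounded_op S ->
  (forall u, T (S u) = Q u) -> (forall u, S (T u) = Q u) ->
  invertible_op Q -> invertible_op T.
Proof.
move=> bT bS h1 h2 [Q' [bQ' h3 h4]].
exists (S \o Q'); split=> [|u|u]; first exact: bounded_op_comp.
  (* [Q = S T = T S] commutes with [T], hence so does its inverse [Q']. *)
  have -> : (S \o Q') (T u) = S (T (Q' u)); last by rewrite h2 h4.
  by rewrite /= -{1}(h4 u) -h2 h1 h3.
by rewrite /= h1 h4.
Qed.

End OperatorPolynomials.

(** * Real polynomials of a self-adjoint operator: real spectrum and positivity *)

Section RealOperatorPolynomials.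
Local Open Scope complex_scope.
Variables (R : realType) (X : Type) (H : rkhs R X).
Implicit Types (T S M : H -> H) (u v w : H) (z : R[i]) (p q : {poly R}).

Lemma poly_opE p T u : poly_op p T u = cpoly_op (map_poly (real_complex R) p) T u.
Proof.
rewrite /poly_op /cpoly_op size_map_poly.
by apply: eq_bigr => i _; rewrite coef_map.
Qed.

Lemma poly_opD p q T u : poly_op (p + q) T u = poly_op p T u + poly_op q T u.
Proof. by rewrite !poly_opE rmorphD cpoly_opD. Qed.

Lemma poly_opC (c : R) T u : poly_op c%:P T u = c%:C *: u.
Proof. by rewrite !poly_opE map_polyC cpoly_opC. Qed.

Lemma poly_opN p T u : poly_op (- p) T u = - poly_op p T u.
Proof. by rewrite !poly_opE rmorphN /= -scaleN1r cpoly_opZ scaleN1r. Qed.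

Lemma poly_opB p q T u : poly_op (p - q) T u = poly_op p T u - poly_op q T u.
Proof. by rewrite poly_opD poly_opN. Qed.

Lemma poly_opX T u : poly_op 'X T u = T u.
Proof. by rewrite poly_opE map_polyX -['X]mul1r cpoly_opMX cpoly_opC scale1r. Qed.

Lemma poly_opZ (c : R) p T u : poly_op (c *: p) T u = c%:C *: poly_op p T u.
Proof. by rewrite !poly_opE map_polyZ cpoly_opZ. Qed.

Lemma poly_opM p q T u : linear T ->
  poly_op (p * q) T u = poly_op p T (poly_op q T u).
Proof. by move=> lT; rewrite !poly_opE rmorphM cpoly_opM. Qed.

Lemma poly_op_bounded p T : bounded_op T -> bounded_op (poly_op p T).
Proof.
move=> bT; rewrite (_ : poly_op p T = cpoly_op (map_poly (real_complex R) p) T).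
  exact: cpoly_op_bounded.
by apply/funext => u; rewrite poly_opE.
Qed.

Lemma poly_op_intertwine p M T S : linear M -> (forall u, M (T u) = S (M u)) ->
  forall u, M (poly_op p T u) = poly_op p S (M u).
Proof. by move=> lM h u; rewrite !poly_opE (cpoly_op_intertwine _ lM h). Qed.

Lemma poly_op_selfadj p T : linear T -> selfadj T -> selfadj (poly_op p T).
Proof.
move=> lT sT; elim/poly_ind: p => [|p c IH] u v.
  by rewrite -(polyC0 R) !poly_opC rinZl rinZr.
rewrite !poly_opD !poly_opM // !poly_opX !poly_opC !rinE; congr (_ + _).
by rewrite IH sT (poly_op_intertwine p lT (fun=> erefl)).
Qed.

(** For [z = a + i b] with [b] nonzero put [D = T - a]. The product of [D - i b] and [D + i b], in
    either order, is [D^2 + b^2], which is coercive with constant [b^2] and so invertible; hence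
    [D - i b = T - z] is invertible. *)
Lemma spectrum_selfadj T z : bounded_op T -> selfadj T -> spectrum T z ->
  complex.Im z = 0.
Proof.
move=> bT sT; have [lT _] := bT; apply: contraPP => /eqP b0; apply.
case: z b0 => a b /= b0.
pose D u := T u - a%:C *: u.
have bD : bounded_op D by exact: bounded_op_subZ.
have [lD _] := bD.
have sD : selfadj D by move=> u v; rewrite /D !rinE sT.
have DE u : D u = T u - a%:C *: u by [].
clearbody D.
pose Q u := D (D u) + (b ^+ 2)%:C *: u.
have bQ : bounded_op Q.
  apply: bounded_op_add; first exact: bounded_op_comp.
  exact/bounded_op_scale/bounded_op_id.
have b2 : 0 < b ^+ 2 by rewrite exprn_even_gt0.
have iQ : invertible_op Q.
  apply: (coercive_invertible bQ _ b2) => [u v|u].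
    by rewrite /Q !rinE !sD.
  by rewrite /Q !rinE sD !rin_sq lerDr sqr_ge0.
pose S c u := D u - (0 +i* c) *: u.
have bS c : bounded_op (S c) by exact: bounded_op_subZ.
have SS c u : c ^+ 2 = b ^+ 2 -> S c (S (- c) u) = Q u.
  move=> cb; rewrite /S linB // linZ // scalerBr scalerA.
  rewrite /Q -cb.
  have -> : (0 +i* - c) = - (0 +i* c) by rewrite -[RHS]/(_ +i* _) oppr0.
  rewrite mulrN (_ : (0 +i* c) * (0 +i* c) = - (c ^+ 2)%:C); last first.
    by apply/eqP; rewrite eq_complex /= !mul0r !mulr0 sub0r addr0 oppr0 !eqxx.
  rewrite !scaleNr !opprK.
  by rewrite opprB addrACA subrr addr0.
suff : invertible_op (S b).
  rewrite (_ : S b = fun u => T u - (a +i* b) *: u) //.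
  apply/funext => u; rewrite /S DE -addrA -opprD -scalerDl; congr (_ - _ *: _).
  by apply/eqP; rewrite eq_complex /= addr0 add0r !eqxx.
apply: (invertible_op_factor (bS b) (bS (- b)) _ _ iQ) => u; first exact: SS.
by rewrite -{2}(opprK b) SS // sqrrN.
Qed.

(* Expand [0 <= rin (S w) w] at [w = u - S u / c]. *)
Lemma positive_sq_bound S c : linear S -> selfadj S ->
  (forall u, 0 <= rin (S u) u) -> 0 < c -> (forall u, nrm (S u) <= c * nrm u) ->
  forall u, nrm (S u) ^+ 2 <= c * rin (S u) u.
Proof.
move=> lS sS pS c0 bS u.
have := pS (u - c^-1%:C *: S u).
rewrite linB // linZ // !rinE rin_sq (sS (S u) u) rin_sq.
have : rin (S (S u)) (S u) <= c * nrm (S u) ^+ 2.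
  apply: le_trans (le_trans (ler_norm _) (rin_cauchy _ _)) _.
  by rewrite expr2 mulrA ler_wpM2r ?nrm_ge0.
rewrite -(ler_pM2l c0) => h1.
rewrite -(pmulr_rge0 _ c0) => h2; rewrite -subr_ge0.
apply: le_trans h2 _.
have : c^-1 ^+ 2 * (c * rin (S (S u)) (S u)) <= c^-1 ^+ 2 * (c * (c * nrm (S u) ^+ 2)).
  by rewrite ler_pM2l // exprn_gt0 // invr_gt0.
have cn : c != 0 by rewrite gt_eqF.
rewrite [X in _ <= X](_ : _ = nrm (S u) ^+ 2); last by field.
rewrite [X in X <= _](_ : _ = c^-1 * rin (S (S u)) (S u)); last by field.
move: (rin (S u) u) (rin (S (S u)) (S u)) (nrm (S u) ^+ 2) => x y n h.
have -> : c * (x - c^-1 * n + (- (c^-1 * n) - c^-1 * - (c^-1 * y))) =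
  c * x - 2 * n + c^-1 * y by field.
lra.
Qed.

(* Otherwise the lower bound [m < 0] of the numerical range of [S] is such that
   [S - m] is positive and invertible, hence coercive, and [m] could be raised. *)
Lemma positive_of_resolvent S : bounded_op S -> selfadj S ->
  (forall m, m < 0 -> invertible_op (fun u => S u - m%:C *: u)) ->
  forall u, 0 <= rin (S u) u.
Proof.
move=> bS sS iS u0; rewrite leNgt; apply/negP => u0lt.
have /bounded_opP[lS [c [c0 hc]]] := bS.
pose E := [set m : R | forall u, m * nrm u ^+ 2 <= rin (S u) u].
have nu0 : 0 < nrm u0.
  rewrite lt_def nrm_ge0 andbT; apply: contraTneq u0lt => /nrm0_eq0 ->.
  by rewrite lin0 // rin0l ltxx.
have u2 : 0 < nrm u0 ^+ 2 by rewrite exprn_gt0.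
have Eub m : E m -> m <= rin (S u0) u0 / nrm u0 ^+ 2.
  by move=> /(_ u0); rewrite ler_pdivlMr.
have supE : has_sup E.
  split; last by exists (rin (S u0) u0 / nrm u0 ^+ 2).
  exists (- c) => u; rewrite mulNr lerNl.
  apply: le_trans (ler_norm _) _; rewrite normrN.
  apply: le_trans (rin_cauchy _ _) _.
  by rewrite expr2 mulrA ler_wpM2r ?nrm_ge0.
set m := sup E.
have Em : E m.
  move=> u; have := nrm_ge0 u; rewrite le_eqVlt => /predU1P[h|h].
    by rewrite (nrm0_eq0 (esym h)) lin0 // rin0l nrm0 expr0n mulr0.
  rewrite -ler_pdivlMr ?exprn_gt0 //; apply: ge_sup; first by case: supE.
  by move=> e /(_ u); rewrite ler_pdivlMr ?exprn_gt0.
have m0 : m < 0.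
  by apply: le_lt_trans (Eub _ Em) _; rewrite pmulr_llt0 ?invr_gt0.
have [V [bV VS _]] := iS m m0.
pose P u := S u - m%:C *: u.
have bP : bounded_op P by exact: bounded_op_subZ.
have /bounded_opP[lP [k [k0 hk]]] := bP.
have /bounded_opP[lV [l [l0 hl]]] := bV.
have Ppos u : 0 <= rin (P u) u.
  by rewrite /P !rinE rin_sq subr_ge0; apply: Em.
have sP : selfadj P by move=> u v; rewrite /P !rinE sS.
have hP := positive_sq_bound lP sP Ppos k0 hk.
(* From [|u| <= l |P u|] and [|P u|^2 <= k <P u, u>] follows [|u|^2 <= l^2 k <P u, u>], so [m] can
   be raised by [e]. *)
pose e := (l ^+ 2 * k)^-1.
have e0 : 0 < e by rewrite invr_gt0 mulr_gt0 // exprn_gt0.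
have : E (m + e).
  move=> u; rewrite mulrDl.
  suff : e * nrm u ^+ 2 <= rin (P u) u by rewrite /P !rinE rin_sq; lra.
  rewrite ler_pdivrMl ?mulr_gt0 ?exprn_gt0 //.
  have : nrm u <= l * nrm (P u) by rewrite -{1}(VS u); apply: hl.
  rewrite -ler_sqr ?nnegrE ?mulr_ge0 ?nrm_ge0 ?(ltW l0) // exprMn => /le_trans.
  by apply; rewrite -[_ * k * _]mulrA ler_pM2l ?exprn_gt0.
move=> /(ub_le_sup supE.2); rewrite -/m; lra.
Qed.

(** With no real spectrum every shift [T - s] satisfies the resolvent condition and is positive,
    even for large [s]; this forces the space to be trivial. *)
Lemma real_spectrum_empty T : bounded_op T -> selfadj T ->
  (forall t : R, ~ spectrum T t%:C) -> forall u, u = 0.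
Proof.
move=> bT sT sp u; have [lT _] := bT; apply: nrm0_eq0; apply/eqP.
apply: contraT => u0; exfalso.
have up : 0 < nrm u ^+ 2 by rewrite exprn_gt0 // lt_def u0 nrm_ge0.
(* Chosen so that [<(T - s) u, u> = -1]. *)
pose s := (rin (T u) u + 1) / nrm u ^+ 2.
pose S v := T v - s%:C *: v.
have bS : bounded_op S by exact: bounded_op_subZ.
have := @positive_of_resolvent S bS.
have sS : selfadj S by move=> v w; rewrite /S !rinE sT.
move=> /(_ sS) h; have : 0 <= rin (S u) u.
  apply: h => m _; apply: contrapT.
  rewrite (_ : (fun u => S u - m%:C *: u) = (fun u => T u - (s + m)%:C *: u)).
    by have := sp (s + m).
  by apply/funext => v; rewrite /S rmorphD scalerDl opprD addrA.
by rewrite /S !rinE rin_sq /s divfK ?gt_eqF //; lra.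
Qed.

(* Spectral mapping: the complex roots of [p - m] are non-real or real numbers
   at which [p] is negative, so they all lie outside the spectrum of [T]. *)
Lemma poly_op_positive T p : bounded_op T -> selfadj T ->
  (forall t : R, spectrum T t%:C -> 0 <= p.[t]) ->
  forall u, 0 <= rin (poly_op p T u) u.
Proof.
move=> bT sT pos; have [lT _] := bT.
(* A spectral point [t] shows below that [p - m] is not the zero polynomial. If the real spectrum is
   empty, the space is trivial. *)
have [/existsNP [t /contrapT tT]|] := pselect (~ forall t : R, ~ spectrum T t%:C);
    last first.
  move=> /contrapT h u; rewrite (real_spectrum_empty bT sT h u).
  by rewrite rinC rin0l.
apply: positive_of_resolvent; first exact: poly_op_bounded.
  exact: poly_op_selfadj.
move=> m m0; pose q := p - m%:P.
rewrite (_ : (fun u => _) = cpoly_op (map_poly (real_complex R) q) T); last first.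
  by apply/funext => u; rewrite -poly_opE /q poly_opB poly_opC.
have q0 : q != 0.
  apply: contraTneq m0 => q0; have := pos t tT.
  have -> : p = m%:P by apply/eqP; rewrite -subr_eq0 -/q q0.
  by rewrite hornerC -leNgt.
apply: cpoly_op_invertible => //; first by rewrite map_poly_eq0.
move=> z zq zT; have := spectrum_selfadj bT sT zT.
case: z zq zT => x y /= zq zT y0; rewrite {}y0 in zq zT.
have := zq; rewrite complexr0 /root horner_map fmorph_eq0 /q !hornerE subr_eq0.
by move=> /eqP h; have := pos x zT; rewrite h leNgt m0.
Qed.

End RealOperatorPolynomials.

(** * Weierstrass approximation *)

Section Weierstrass.
Variable R : realType.
Implicit Types (f : R -> R) (a b e t x : R).

(** Nearby points are handled by continuity; for distant ones the total oscillation is absorbed by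
    [K (s - t)^2]. A quadratic error is what the Bernstein operator evaluates exactly. *)
Lemma segment_quadratic_modulus f a b e : a <= b ->
  {within `[a, b], continuous f} -> 0 < e ->
  exists K, forall s t, a <= s <= b -> a <= t <= b ->
    `|f s - f t| <= e + K * (s - t) ^+ 2.
Proof.
move=> ab cf e0.
have [c _ fmax] := EVT_max ab cf; have [d _ fmin] := EVT_min ab cf.
pose F := f c - f d.
have fF s t : a <= s <= b -> a <= t <= b -> `|f s - f t| <= F.
  move=> sab tab; rewrite ler_norml /F.
  have := fmax s; have := fmax t; have := fmin s; have := fmin t.
  rewrite !in_itv /= => /(_ tab) ? /(_ sab) ? /(_ tab) ? /(_ sab) ?.
  apply/andP; split; lra.
have F0 : 0 <= F by apply: le_trans (fF a a _ _); rewrite ?normr_ge0 ?lexx.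
(* Compactness in near-covering form, with [K] tending to infinity as parameter: a bound valid near
   each point yields one [K] for the whole segment. *)
have /compact_near_coveringP/near_covering_withinP cov := @segment_compact R a b.
have e2 : 0 < e / 2 by lra.
have [|M [_ hM]] := @cov R (pinfty_nbhs R)
    (fun K s => forall t, a <= t <= b -> `|f s - f t| <= e + K * (s - t) ^+ 2) _.
  move=> x xab; rewrite /= in_itv /= in xab.
  move/subspace_continuousP: cf => /(_ x); rewrite /= in_itv /= => /(_ xab).
  move=> /cvgrPdist_le /(_ _ e2); rewrite near_withinE => -[r /= r0 hr].
  have hr' y : a <= y <= b -> `|x - y| < r -> `|f x - f y| <= e / 2.
    by move=> yab xy; apply: hr => //=; rewrite in_itv.
  have r2 : 0 < r / 2 by lra.
  (* If [s] is within [r / 2] of [x] and [t] within [r / 2] of [s], both are within [r] of [x];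
     otherwise [K (s - t)^2] is at least [F]. *)
  exists (ball x (r / 2), [set K | F / (r / 2) ^+ 2 <= K]).
    split=> /=; first exact: nbhsx_ballx.
    exists (F / (r / 2) ^+ 2); split; [exact: num_real|by move=> K /ltW].
  move=> [s K] /= [xs hK]; rewrite in_itv /= => sab t tab.
  have K0 : 0 <= K by apply: le_trans hK; rewrite divr_ge0 ?sqr_ge0.
  rewrite -ball_normE /= in xs.
  have [st|st] := leP (r / 2) `|s - t|.
    apply: le_trans (fF _ _ sab tab) _.
    have : (r / 2) ^+ 2 <= (s - t) ^+ 2.
      by rewrite -[leRHS]real_normK ?num_real // ler_sqr ?nnegrE // ltW.
    move=> h; have : K * (r / 2) ^+ 2 <= K * (s - t) ^+ 2 by exact: ler_wpM2l.
    move: hK; rewrite ler_pdivrMr ?exprn_gt0 //; lra.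
  have h1 : `|f x - f s| <= e / 2 by apply: hr' => //; lra.
  have h2 : `|f x - f t| <= e / 2.
    apply: hr' => //; have := ler_normD (x - s) (s - t); rewrite subrKA; lra.
  have h3 := ler_distD (f x) (f s) (f t); rewrite (distrC (f s) (f x)) in h3.
  have : 0 <= K * (s - t) ^+ 2 by rewrite mulr_ge0 ?sqr_ge0.
  lra.
exists (M + 1) => s t sab tab; apply: hM => //; lra.
Qed.

(* The Bernstein operator [sum_k binom(n,k) g(k) X^k (1 - X)^(n-k)], in the
   recursive form given by Pascal's rule. *)
Fixpoint bernstein n (g : nat -> R) : {poly R} :=
  if n is m.+1 then
    (1 - 'X) * bernstein m g + 'X * bernstein m (fun k => g k.+1)
  else (g 0%N)%:P.

Lemma bernstein_le n g h x : 0 <= x <= 1 ->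
  (forall k, (k <= n)%N -> g k <= h k) ->
  (bernstein n g).[x] <= (bernstein n h).[x].
Proof.
move=> x01; elim: n g h => [|n IH] g h gh /=; first by rewrite !hornerC gh.
rewrite !hornerE; apply: lerD; apply: ler_wpM2l; try by lra.
  by apply: IH => k kn; apply: gh; exact: leqW.
by apply: IH => k kn; apply: gh.
Qed.

(** The second moment of the binomial law: mean [n x] and variance [n (x - x^2)]. *)
Lemma bernstein_sqr n (A M c : R) x :
  (bernstein n (fun k => A + M * (k%:R - c) ^+ 2)).[x] =
  A + M * ((n%:R * x - c) ^+ 2 + n%:R * (x - x ^+ 2)).
Proof.
elim: n c => [|n IH] c /=; first by rewrite hornerC; ring.
rewrite !hornerE IH.
have -> : (fun k => A + M * (k.+1%:R - c) ^+ 2) =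
    (fun k => A + M * (k%:R - (c - 1)) ^+ 2).
  by apply/funext => k; rewrite -natr1; ring.
by rewrite IH -natr1; ring.
Qed.

(** The samples [g k] lie between the quadratics [f t -+ (e / 2 + M (k - n x)^2)]. The Bernstein
    operator is monotone, and on these quadratics it leaves only the variance term, which is small
    for large [n]. *)
Theorem weierstrass f b e : 0 < b -> {within `[0, b], continuous f} -> 0 < e ->
  exists p : {poly R}, forall t, 0 <= t <= b -> `|p.[t] - f t| <= e.
Proof.
move=> b0 cf e0; have e2 : 0 < e / 2 by lra.
have [K hK] := segment_quadratic_modulus (ltW b0) cf e2.
(* The variance term is at most [L / n], so [n] is taken with [1 / n <= (e / 2) / L]; the summand 1
   keeps [L] positive. *)
pose L := `|K| * b ^+ 2 + 1.
have L0 : 0 < L by rewrite ltr_wpDl // mulr_ge0 ?sqr_ge0.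
have [N /(_ N (leqnn N)) hN] := archi_inv (divr_gt0 e2 L0).
have n0 : 0 < N.+1%:R :> R by rewrite ltr0n.
move: N.+1 hN n0 => n hN n0.
pose g k := f (b * (k%:R / n%:R)).
exists (bernstein n g \Po (b^-1 *: 'X)) => t /andP[t0 tb].
rewrite horner_comp !hornerE; set x := b^-1 * t.
have x01 : 0 <= x <= 1.
  by rewrite /x mulr_ge0 ?invr_ge0 ?(ltW b0) //= mulrC ler_pdivrMr // mul1r.
have tE : t = b * x by rewrite /x mulVKf // gt_eqF.
pose M := `|K| * (b / n%:R) ^+ 2.
have gM k : (k <= n)%N -> `|g k - f t| <= e / 2 + M * (k%:R - n%:R * x) ^+ 2.
  move=> kn; have h : 0 <= b * (k%:R / n%:R) <= b.
    apply/andP; split.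
      by rewrite !mulr_ge0 ?invr_ge0 ?ler0n ?(ltW b0).
    by rewrite ler_piMr ?(ltW b0) // ler_pdivrMr // mul1r ler_nat.
  apply: le_trans (hK _ t h _) _; first by rewrite t0.
  rewrite lerD2l /M tE.
  have -> : b * (k%:R / n%:R) - b * x = b / n%:R * (k%:R - n%:R * x).
    by field; rewrite gt_eqF.
  by rewrite exprMn mulrA ler_wpM2r ?sqr_ge0 // ler_wpM2r ?sqr_ge0 // ler_norm.
have Me : M * (n%:R * (x - x ^+ 2)) <= e / 2.
  have -> : M * (n%:R * (x - x ^+ 2)) = `|K| * b ^+ 2 * (x - x ^+ 2) * n%:R^-1.
    by rewrite /M; field; rewrite gt_eqF.
  apply: (@le_trans _ _ (L * n%:R^-1)); last by rewrite -ler_pdivlMl // mulrC.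
  rewrite ler_pM2r ?invr_gt0 //.
  have h : 0 <= `|K| * b ^+ 2 by rewrite mulr_ge0 ?sqr_ge0.
  apply: (@le_trans _ _ (`|K| * b ^+ 2 * 1)); last by rewrite /L; lra.
  rewrite ler_wpM2l //; have := sqr_ge0 x; lra.
rewrite ler_norml; apply/andP; split.
  have := @bernstein_le n (fun k => (f t - e / 2) + (- M) * (k%:R - n%:R * x) ^+ 2)
    g x x01.
  rewrite bernstein_sqr subrr expr0n add0r mulNr => h.
  have {h} : f t - e / 2 - M * (n%:R * (x - x ^+ 2)) <= (bernstein n g).[x].
    by apply: h => k /gM; rewrite ler_norml; lra.
  lra.
have := @bernstein_le n g (fun k => (f t + e / 2) + M * (k%:R - n%:R * x) ^+ 2)
  x x01.
rewrite bernstein_sqr subrr expr0n add0r => h.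
have {h} : (bernstein n g).[x] <= f t + e / 2 + M * (n%:R * (x - x ^+ 2)).
  by apply: h => k /gM; rewrite ler_norml; lra.
lra.
Qed.

Lemma powR_continuous (r : R) : 0 <= r ->
  {within `[0, +oo[, continuous (fun t => t `^ r)}.
Proof.
rewrite le_eqVlt => /predU1P[<-|r0].
  rewrite (_ : (fun t => _) = cst 1); last by apply/funext => t; rewrite powRr0.
  by apply: continuous_subspaceT => t; exact: cvg_cst.
apply/continuous_within_itvcyP; split; last first.
  by rewrite powR0 ?gt_eqF //; exact: powR_cvg0.
move=> t t0; apply: differentiable_continuous; apply/derivable1_diffP.
exact: derivable_powR.
Qed.

Lemma within_segment f b : {within `[0, +oo[, continuous f} ->
  {within `[0, b], continuous f}.
Proof. by apply: continuous_subspaceW => t /=; rewrite !in_itv /= => /andP[->]. Qed.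

End Weierstrass.

(** * Continuous functional calculus *)

Lemma ler_eps_mul (R : realType) (x y z : R) : 0 <= z ->
  (forall e, 0 < e -> x <= y + e * z) -> x <= y.
Proof.
move=> z0 h; apply/ler_addgt0Pr => e e0.
have z1 : 0 < z + 1 by lra.
apply: le_trans (h _ (divr_gt0 e0 z1)) _; rewrite lerD2l.
rewrite mulrAC ler_pdivrMr // ler_pM2l //; lra.
Qed.

Section FunctionalCalculus.
Local Open Scope complex_scope.
Variables (R : realType) (X : Type) (H : rkhs R X).
Variables (T : H -> H) (bT : bounded_op T) (sT : selfadj T).
Implicit Types (S : H -> H) (f : R -> R) (u v w : H) (p q : {poly R}).

Let lT : linear T. Proof. by case: bT. Qed.

(** [e^2 - p^2] is nonnegative on the spectrum, so its operator is positive: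
    [|p(T) u|^2 <= e^2 |u|^2]. *)
Lemma poly_op_norm p e : 0 <= e ->
  (forall t : R, spectrum T t%:C -> `|p.[t]| <= e) ->
  forall u, nrm (poly_op p T u) <= e * nrm u.
Proof.
move=> e0 pe u.
have := @poly_op_positive _ _ _ T ((e ^+ 2)%:P - p * p) bT sT.
have h t : spectrum T t%:C -> 0 <= ((e ^+ 2)%:P - p * p).[t].
  move=> /pe h; rewrite !hornerE subr_ge0 -expr2 -real_normK ?num_real //.
  by rewrite ler_sqr ?nnegrE.
move=> /(_ h u); rewrite poly_opB poly_opC poly_opM // !rinE.
rewrite (poly_op_selfadj p lT sT) !rin_sq subr_ge0 -exprMn.
by rewrite ler_sqr ?nnegrE ?mulr_ge0 ?nrm_ge0.
Qed.

Lemma is_fun_calcP f S : is_fun_calc f T S <->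
  forall e, 0 < e -> exists p,
    (forall t : R, spectrum T t%:C -> `|p.[t] - f t| <= e) /\
    (forall u, nrm (poly_op p T u - S u) <= e * nrm u).
Proof.
split=> h e /h [p [h1 h2]]; exists p; split=> // u.
  by have := h2 u; rewrite !nrmE -rmorphM lecR.
by rewrite !nrmE -rmorphM lecR.
Qed.

Section Calculus.
Variables (f : R -> R) (S : H -> H) (fS : is_fun_calc f T S).

(** The definition only supplies some approximating polynomials [q]. Comparing [p] with [q] through
    [poly_op_norm] lets any polynomial close to [f] on the spectrum be used. *)
Lemma fun_calc_approx p e : 0 <= e ->
  (forall t : R, spectrum T t%:C -> `|p.[t] - f t| <= e) ->
  forall u, nrm (poly_op p T u - S u) <= e * nrm u.
Proof.
move=> e0 pf u; apply: (@ler_eps_mul _ _ _ (2 * nrm u)).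
  by rewrite mulr_ge0 ?nrm_ge0.
move=> d d0; have [q [h1 h2]] := (is_fun_calcP f S).1 fS d d0.
have := @poly_op_norm (p - q) (e + d) _ _ u; rewrite poly_opB => h3.
have {h3} : nrm (poly_op p T u - poly_op q T u) <= (e + d) * nrm u.
  apply: h3 => [|t tT]; first lra.
  rewrite !hornerE; have := h1 t tT; rewrite distrC => ?; have := pf t tT => ?.
  by apply: le_trans (ler_distD (f t) _ _) _; lra.
have := nrmD (poly_op p T u - poly_op q T u) (poly_op q T u - S u).
rewrite subrKA; have := h2 u; lra.
Qed.

Lemma fun_calc_linear : linear S.
Proof.
move=> a u v; apply/eqP; rewrite -subr_eq0; apply/eqP/nrm0_eq0/eqP.
rewrite eq_le nrm_ge0 andbT.
set na := normc a.
have na0 : 0 <= na := normc_ge0 a.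
apply: (@ler_eps_mul _ _ _ (nrm (a *: u + v) + na * nrm u + nrm v)).
  by rewrite !addr_ge0 ?mulr_ge0 ?nrm_ge0.
move=> d d0; have [p [_ h]] := (is_fun_calcP f S).1 fS d d0.
have [lp _] := poly_op_bounded p bT.
have -> : S (a *: u + v) - (a *: S u + S v) =
    - (poly_op p T (a *: u + v) - S (a *: u + v)) +
    (a *: (poly_op p T u - S u) + (poly_op p T v - S v)).
  by rewrite lp opprB scalerBr [a *: _ - _ + _]addrACA -opprD subrKA.
rewrite add0r; apply: le_trans (nrmD _ _) _; rewrite nrmN.
have := nrmD (a *: (poly_op p T u - S u)) (poly_op p T v - S v).
rewrite nrmZ -/na; have := h (a *: u + v); have := h v.
have : na * nrm (poly_op p T u - S u) <= na * (d * nrm u) by rewrite ler_wpM2l.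
lra.
Qed.

Lemma fun_calc_bounded : bounded_op S.
Proof.
apply/bounded_opP; split; first exact: fun_calc_linear.
have [p [_ h]] := (is_fun_calcP f S).1 fS 1 ltr01.
have /bounded_opP[_ [c [c0 hc]]] := poly_op_bounded p bT.
exists (c + 1); split=> [|u]; first lra.
have := nrmD (poly_op p T u) (S u - poly_op p T u).
rewrite subrKC (nrmB (S u)); have := h u; have := hc u; lra.
Qed.

Lemma fun_calc_selfadj : selfadj S.
Proof.
move=> u v; apply/eqP; rewrite -subr_eq0 -normr_le0.
apply: (@ler_eps_mul _ _ _ (2 * (nrm u * nrm v))).
  by rewrite !mulr_ge0 ?nrm_ge0.
move=> d d0; have [p [_ h]] := (is_fun_calcP f S).1 fS d d0.
have -> : rin (S u) v - rin u (S v) =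
    rin u (poly_op p T v - S v) - rin (poly_op p T u - S u) v.
  by rewrite !rinE (poly_op_selfadj p lT sT); ring.
apply: le_trans (ler_normB _ _) _.
have h1 := rin_cauchy u (poly_op p T v - S v).
have h2 := rin_cauchy (poly_op p T u - S u) v.
have h3 := ler_wpM2l (nrm_ge0 u) (h v).
have h4 := ler_wpM2r (nrm_ge0 v) (h u).
lra.
Qed.

(** If [q] is within [d] of [f] on the spectrum, then [q + d - p] is nonnegative there; let [d] tend
    to 0. *)
Lemma fun_calc_ge_poly p : (forall t : R, spectrum T t%:C -> p.[t] <= f t) ->
  forall u, rin (poly_op p T u) u <= rin (S u) u.
Proof.
move=> pf u; apply: (@ler_eps_mul _ _ _ (2 * nrm u ^+ 2)).
  by rewrite mulr_ge0 ?sqr_ge0.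
move=> d d0; have [q [h1 h2]] := (is_fun_calcP f S).1 fS d d0.
have := @poly_op_positive _ _ _ T (q + d%:P - p) bT sT _ u.
rewrite poly_opB poly_opD poly_opC !rinE rin_sq => h3.
have {}h3 := h3 _.
have {h3} : 0 <= rin (poly_op q T u) u + d * nrm u ^+ 2 - rin (poly_op p T u) u.
  apply: h3 => t tT; rewrite !hornerE.
  have := h1 t tT; rewrite ler_norml => /andP[? ?]; have := pf t tT; lra.
have := le_trans (ler_norm _) (rin_cauchy (poly_op q T u - S u) u).
have := ler_wpM2r (nrm_ge0 u) (h2 u); rewrite !rinE; lra.
Qed.

End Calculus.

(** * Positive operators: location of the spectrum and existence of the calculus *)

Hypothesis pT : forall u, 0 <= rin (T u) u.

Lemma spectrum_ge0 (t : R) : spectrum T t%:C -> 0 <= t.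
Proof.
move=> tT; rewrite leNgt; apply/negP => t0; apply: tT.
have t1 : 0 < - t by lra.
apply: (coercive_invertible (P := fun u => T u - t%:C *: u) _ _ t1).
- exact: bounded_op_subZ.
- by move=> u v; rewrite !rinE sT.
- by move=> u; rewrite !rinE rin_sq mulNr; have := pT u; lra.
Qed.

(** For [t > b] the operator [t - T] is coercive with constant [t - b]; [T - t] is its opposite. *)
Lemma spectrum_le (b t : R) : (forall u, nrm (T u) <= b * nrm u) ->
  spectrum T t%:C -> t <= b.
Proof.
move=> hb tT; rewrite leNgt; apply/negP => bt; apply: tT.
have t1 : 0 < t - b by lra.
change (invertible_op (fun u => T u - t%:C *: u)).
rewrite (_ : (fun u => _) =
    (fun u : H => (-1) *: u) \o (fun u => t%:C *: u + (-1) *: T u)); last first.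
  by apply/funext => u; rewrite /= !scaleN1r opprB.
apply: invertible_op_comp; first by apply: invertible_op_scale; rewrite oppr_eq0 oner_eq0.
apply: (coercive_invertible (P := fun u => t%:C *: u + (-1) *: T u) _ _ t1).
- apply: bounded_op_add; first exact/bounded_op_scale/bounded_op_id.
  exact: bounded_op_scale.
- by move=> u v; rewrite !scaleN1r !rinE sT.
- move=> u; rewrite scaleN1r !rinE rin_sq mulrBl.
  have := le_trans (ler_norm _) (rin_cauchy (T u) u).
  have := ler_wpM2r (nrm_ge0 u) (hb u); lra.
Qed.

Lemma spectrum_itv (b t : R) : (forall u, nrm (T u) <= b * nrm u) ->
  spectrum T t%:C -> 0 <= t <= b.
Proof. by move=> hb tT; rewrite spectrum_ge0 //= (spectrum_le hb). Qed.

Lemma fun_calc_exists f : {within `[0, +oo[, continuous f} ->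
  is_fun_calc f T (fun_calc f T).
Proof.
move=> cf; suff [S hS] : exists S, is_fun_calc f T S
  by apply: (xgetPex (fun=> 0 : H) (P := [set S | is_fun_calc f T S])); exists S.
have /bounded_opP[_ [b [b0 hb]]] := bT.
have sp t := @spectrum_itv b t hb.
have /choice [p hp] n : exists p : {poly R},
    forall t, 0 <= t <= b -> `|p.[t] - f t| <= n.+1%:R^-1.
  by apply: weierstrass => //; exact: within_segment.
have pp m n u : nrm (poly_op (p m) T u - poly_op (p n) T u) <=
    (m.+1%:R^-1 + n.+1%:R^-1) * nrm u.
  rewrite -poly_opB; apply: poly_op_norm => [|t /sp tb].
    by rewrite addr_ge0 ?invr_ge0.
  rewrite !hornerE; apply: le_trans (ler_distD (f t) _ _) _.
  by rewrite (distrC (f t)) lerD ?hp.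
have /choice [S hS] u : exists l, forall e, 0 < e -> exists N, forall n,
    (N <= n)%N -> nrm (poly_op (p n) T u - l) <= e.
  apply: hilbert_complete => e e0.
  pose d := e / 2 / (nrm u + 1).
  have u1 : 0 < nrm u + 1 by have := nrm_ge0 u; lra.
  have d0 : 0 < d by rewrite /d !divr_gt0.
  have [N hN] := archi_inv d0; exists N => m n Nm Nn.
  apply: le_trans (pp _ _ _) _; apply: (@le_trans _ _ ((d + d) * (nrm u + 1))).
    apply: ler_pM; rewrite ?addr_ge0 ?invr_ge0 ?nrm_ge0 ?lerD ?hN //; lra.
  by rewrite -mulr2n -mulr_natr mulrAC /d divfK ?gt_eqF //; lra.
exists S; apply/is_fun_calcP => e e0; have [N /(_ N (leqnn N)) hN] := archi_inv e0.
exists (p N); split=> [t /sp tb|u]; first exact: le_trans (hp _ _ tb) hN.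
(* The choice of [N] must not depend on [u]: let [n] tend to infinity in [pp N n], leaving the bound
   [|u| / (N + 1)]. *)
apply: (@le_trans _ _ (N.+1%:R^-1 * nrm u)); last first.
  by rewrite ler_wpM2r ?nrm_ge0.
apply: (@ler_eps_mul _ _ _ (nrm u + 1)).
  by have := nrm_ge0 u; lra.
move=> d d0; have [N1 hN1] := archi_inv d0; have [N2 hN2] := hS u d d0.
pose n := maxn N1 N2.
have := hN1 n (leq_maxl _ _); have := hN2 n (leq_maxr _ _).
have := nrmD (poly_op (p N) T u - poly_op (p n) T u) (poly_op (p n) T u - S u).
rewrite subrKA; have := pp N n u.
move: (n.+1%:R^-1) => r h1 h2 h3 h4.
have : r * nrm u <= d * nrm u by rewrite ler_wpM2r ?nrm_ge0.
move: h1; move: (N.+1%:R^-1) => r'; lra.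
Qed.

End FunctionalCalculus.

(** * The mixed Schwarz inequality *)

(** Restricting to [e <= 1] allows terms in [e^2] to be absorbed into terms in [e]. *)
Lemma ler_eps_mul1 (R : realType) (x y z : R) : 0 <= z ->
  (forall e, 0 < e <= 1 -> x <= y + e * z) -> x <= y.
Proof.
move=> z0 h; apply: (ler_eps_mul z0) => e e0.
have [e1|e1] := leP e 1; first by apply: h; rewrite e0.
have := h 1; rewrite ltr01 lexx => /(_ isT) /le_trans; apply.
by rewrite lerD2l ler_wpM2r // ltW.
Qed.

(** [p] approximates [g + 2 d] within [d], so it is positive on the segment, and [q] approximates
    [1 / p]. The last bound is [p q^2 t^2 = (p q)^2 t^2 / p] together with [t^2 = g h <= p h]. *)
Lemma poly_approx_inverse (R : realType) (g h : R -> R) (b d : R) :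
  0 < b -> 0 < d <= 1 -> {within `[0, +oo[, continuous g} ->
  (forall t, 0 <= t -> 0 <= g t) -> (forall t, 0 <= t -> 0 <= h t) ->
  (forall t, 0 <= t -> g t * h t = t ^+ 2) ->
  exists p q : {poly R}, forall t, 0 <= t <= b ->
    [/\ g t <= p.[t], p.[t] <= g t + 3 * d, `|1 - p.[t] * q.[t]| <= d &
        p.[t] * q.[t] ^+ 2 * t ^+ 2 <= (1 + 3 * d) * h t].
Proof.
move=> b0 /andP[d0 d1] cg g0 h0 gh.
have [|p hp] := @weierstrass R (fun t => g t + 2 * d) b d b0 _ d0.
  apply/subspace_continuousP => t tb; apply: cvgD; last exact: cvg_cst.
  by move: t tb; apply/subspace_continuousP; exact: within_segment.
have gp t : 0 <= t <= b -> g t + d <= p.[t] <= g t + 3 * d.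
  by move=> /hp; rewrite ler_norml => /andP[? ?]; apply/andP; split; lra.
have p0 t : 0 <= t <= b -> 0 < p.[t].
  move=> tb; have /andP[+ _] := gp t tb; move/andP: tb => [/g0]; lra.
have cp : {within `[0, b], continuous (horner p)}.
  by apply: continuous_subspaceT => t; exact: continuous_horner.
have [c cb pc] := EVT_max (ltW b0) cp.
have c0 : 0 < p.[c] by apply: p0; rewrite in_itv in cb.
(* The tolerance is divided by the maximum of [p], so that multiplying by [p] leaves an error of at
   most [d]. *)
have [|q hq] := @weierstrass R (fun t => p.[t]^-1) b (d / p.[c]) b0 _ (divr_gt0 d0 c0).
  apply/subspace_continuousP => t tb; apply: cvgV.
    by rewrite gt_eqF // p0 //; rewrite /= in_itv in tb.
  by move: t tb; apply/subspace_continuousP.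
exists p, q => t tb; have /andP[h1 h2] := gp t tb; have pt := p0 t tb.
have h3 : `|1 - p.[t] * q.[t]| <= d.
  have -> : 1 - p.[t] * q.[t] = p.[t] * (p.[t]^-1 - q.[t]).
    by rewrite mulrBr divff ?gt_eqF.
  rewrite normrM (gtr0_norm pt) distrC.
  apply: (@le_trans _ _ (p.[c] * (d / p.[c]))); last by rewrite mulrC divfK ?gt_eqF.
  by rewrite ler_pM ?(ltW pt) ?hq // pc // in_itv.
have /andP[t0 _] := tb; have ht := h0 t t0.
split=> //; first lra.
set r := p.[t] * q.[t] in h3 *.
have rE : r ^+ 2 <= 1 + 3 * d.
  have /andP[r1 r2] : - d <= 1 - r <= d by rewrite -ler_norml.
  have : r ^+ 2 <= (1 + d) ^+ 2 by rewrite ler_sqr ?nnegrE; lra.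
  have : d * d <= d * 1 by rewrite ler_wpM2l // ltW.
  rewrite sqrrD; lra.
have -> : p.[t] * q.[t] ^+ 2 * t ^+ 2 = r ^+ 2 * (t ^+ 2 / p.[t]).
  by rewrite /r; field; rewrite gt_eqF.
apply: ler_pM; rewrite ?sqr_ge0 ?divr_ge0 ?sqr_ge0 ?(ltW pt) //.
by rewrite ler_pdivrMr // -gh // mulrC ler_wpM2l //; lra.
Qed.

Section AbsoluteValue.
Local Open Scope complex_scope.
Variables (R : realType) (X : Type) (H : rkhs R X).
Implicit Types (M : H -> H) (u v w : H).

Lemma gram_facts M (bM : bounded_op M) : let P := adjoint M \o M in
  [/\ bounded_op P, selfadj P & forall u, 0 <= rin (P u) u].
Proof.
have [bA hA] := adjointP bM.
split; first exact: bounded_op_comp.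
- by move=> u v /=; rewrite -hA rinC -hA rinC.
- by move=> u /=; rewrite rinC -hA rin_sq sqr_ge0.
Qed.

Lemma op_pow_facts T (r : R) : bounded_op T -> selfadj T ->
  (forall u : H, 0 <= rin (T u) u) -> 0 <= r ->
  [/\ is_fun_calc (fun t => t `^ r) T (op_pow T r),
      bounded_op (op_pow T r), selfadj (op_pow T r) &
      forall u, 0 <= rin (op_pow T r u) u].
Proof.
move=> bT sT pT r0.
have fc := fun_calc_exists bT sT pT (powR_continuous r0).
split=> //; first exact: fun_calc_bounded fc.
  exact: fun_calc_selfadj fc.
move=> u; have := fun_calc_ge_poly bT sT fc (p := 0) _ u.
rewrite -(polyC0 R) poly_opC rinZl mul0r; apply => t _.
by rewrite hornerC powR_ge0.
Qed.

Lemma op_abs_facts M : bounded_op M ->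
  [/\ is_fun_calc (fun t => t `^ 2^-1) (adjoint M \o M) (op_abs M),
      bounded_op (op_abs M), selfadj (op_abs M) &
      forall u, 0 <= rin (op_abs M u) u].
Proof.
move=> bM; have [bP sP pP] := gram_facts bM.
exact: op_pow_facts.
Qed.

Lemma op_abs_sq M : bounded_op M -> forall u, op_abs M (op_abs M u) = adjoint M (M u).
Proof.
move=> bM u; have [bP sP pP] := gram_facts bM.
have [fE bE _ _] := op_abs_facts bM.
set P := adjoint M \o M in bP sP pP fE *; set E := op_abs M in fE bE *.
have /bounded_opP[lP [b [b0 hb]]] := bP.
have /bounded_opP[lE [c [c0 hc]]] := bE.
have sp t := spectrum_itv bP sP pP hb (t := t).
pose C := b `^ 2^-1.
have C0 : 0 <= C by exact: powR_ge0.
apply/eqP; rewrite -subr_eq0; apply/eqP/nrm0_eq0/eqP.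
rewrite eq_le nrm_ge0 andbT.
(* With [p] close to the square root, [2 c + 1] collects the errors of replacing each [E] by [p(P)],
   and [2 C + 1] that of replacing [p^2] by [t]. *)
apply: (@ler_eps_mul1 _ _ _ ((2 * c + 1 + (2 * C + 1)) * nrm u)).
  by rewrite mulr_ge0 ?nrm_ge0 //; lra.
move=> d /andP[d0 d1]; rewrite add0r.
have [|p hp] := @weierstrass R (fun t => t `^ 2^-1) b d b0 _ d0.
  by apply/within_segment/powR_continuous; rewrite invr_ge0.
have pE v : nrm (poly_op p P v - E v) <= d * nrm v.
  by apply: (fun_calc_approx bP sP fE (ltW d0)) => t /sp /hp.
have pp : nrm (poly_op p P (poly_op p P u) - P u) <= d * (2 * C + 1) * nrm u.
  rewrite -poly_opM // -(poly_opX P) -poly_opB.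
  apply: (poly_op_norm bP sP); first by rewrite mulr_ge0 ?(ltW d0) //; lra.
  move=> t /sp tb; rewrite !hornerE.
  have /andP[t0 tb'] := tb; have := hp t tb; set s := t `^ 2^-1 => ps.
  have s0 : 0 <= s by exact: powR_ge0.
  have sC : s <= C.
    by apply: ge0_ler_powR; rewrite ?invr_ge0 ?nnegrE // ltW.
  have tE : t = s ^+ 2 by rewrite /s powR12_sqrt // sqr_sqrtr.
  rewrite [X in _ - X]tE.
  have -> : p.[t] * p.[t] - s ^+ 2 = (p.[t] - s) * (p.[t] - s + 2 * s) by ring.
  rewrite normrM ler_pM //.
  apply: le_trans (ler_normD _ _) _.
  rewrite (ger0_norm (mulr_ge0 _ s0)) //; lra.
have h1 := hc (E u - poly_op p P u).
have h2 := pE (poly_op p P u).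
have h3 := pE u.
have h4 := hc u.
have h5 : nrm (poly_op p P u) <= (c + d) * nrm u.
  by have := nrmD (poly_op p P u - E u) (E u); rewrite subrK; lra.
rewrite nrmB in h2; rewrite nrmB in h1.
have -> : E (E u) - adjoint M (M u) = E (E u - poly_op p P u) +
   (E (poly_op p P u) - poly_op p P (poly_op p P u)) +
   (poly_op p P (poly_op p P u) - P u).
  by rewrite (linB lE) !subrKA.
have := nrmD (E (E u - poly_op p P u) +
   (E (poly_op p P u) - poly_op p P (poly_op p P u)))
   (poly_op p P (poly_op p P u) - P u).
have := nrmD (E (E u - poly_op p P u))
   (E (poly_op p P u) - poly_op p P (poly_op p P u)).
have h6 := nrm_ge0 u.
have h7 : d * nrm (poly_op p P u) <= d * ((c + 1) * nrm u).
  rewrite ler_wpM2l ?(ltW d0) //; apply: le_trans h5 _.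
  by rewrite ler_wpM2r // lerD2l.
have h8 : nrm (E (E u - poly_op p P u)) <= c * (d * nrm u).
  apply: le_trans (hc _) _; rewrite ler_pM2l // nrmB; exact: h3.
lra.
Qed.

(** [M] intertwines [adjoint M \o M] with [M \o adjoint M], hence also their polynomials, and in the
    limit their square roots. *)
Lemma op_abs_intertwine M : bounded_op M ->
  forall u, M (op_abs M u) = op_abs (adjoint M) (M u).
Proof.
move=> bM u; have [bA _] := adjointP bM.
have [bP sP pP] := gram_facts bM; have [bQ sQ pQ] := gram_facts bA.
have [fE _ _ _] := op_abs_facts bM; have [fF _ _ _] := op_abs_facts bA.
rewrite adjointK // in bQ sQ pQ fF.
set P := adjoint M \o M in bP sP pP fE *; set E := op_abs M in fE *.
set Q := M \o adjoint M in bQ sQ pQ fF *; set F := op_abs (adjoint M) in fF *.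
have /bounded_opP[lP [b [b0 hb]]] := bP.
have /bounded_opP[lQ [b' [b0' hb']]] := bQ.
have /bounded_opP[lM [c [c0 hc]]] := bM.
(* A common interval for both spectra, so that one polynomial approximates both square roots. *)
have sp t : spectrum P t%:C -> 0 <= t <= b + b'.
  move=> tP; rewrite (spectrum_ge0 bP) //=.
  by rewrite (le_trans (spectrum_le bP sP hb tP)) // lerDl ltW.
have sp' t : spectrum Q t%:C -> 0 <= t <= b + b'.
  move=> tQ; rewrite (spectrum_ge0 bQ) //=.
  by rewrite (le_trans (spectrum_le bQ sQ hb' tQ)) // lerDr ltW.
apply/eqP; rewrite -subr_eq0; apply/eqP/nrm0_eq0/eqP.
rewrite eq_le nrm_ge0 andbT.
apply: (@ler_eps_mul _ _ _ (2 * c * nrm u)).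
  by rewrite !mulr_ge0 ?nrm_ge0 // ltW.
move=> d d0; rewrite add0r.
have [|p hp] := @weierstrass R (fun t => t `^ 2^-1) (b + b') d (addr_gt0 b0 b0') _ d0.
  by apply/within_segment/powR_continuous; rewrite invr_ge0.
have pE v : nrm (poly_op p P v - E v) <= d * nrm v.
  by apply: (fun_calc_approx bP sP fE (ltW d0)) => t /sp /hp.
have pF v : nrm (poly_op p Q v - F v) <= d * nrm v.
  by apply: (fun_calc_approx bQ sQ fF (ltW d0)) => t /sp' /hp.
have -> : M (E u) - F (M u) =
    - M (poly_op p P u - E u) + (poly_op p Q (M u) - F (M u)).
  have <- : M (poly_op p P u) = poly_op p Q (M u).
    exact: (poly_op_intertwine p (T := P) (S := Q) lM).
  by rewrite (linB lM) opprB subrKA.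
apply: le_trans (nrmD _ _) _; rewrite nrmN.
have h1 := hc (poly_op p P u - E u); have h2 := pF (M u).
have h3 : c * nrm (poly_op p P u - E u) <= c * (d * nrm u) by rewrite ler_pM2l.
have h4 : d * nrm (M u) <= d * (c * nrm u) by rewrite ler_pM2l.
lra.
Qed.

(* Completing the square in the positive form of [p(|M|)], where [p] is close
   to [t^(2 alpha)] and [q] to [1 / p], at [u - q(|M|) M^* v]. *)
Lemma mixed_schwarz_real M (a : R) u v : bounded_op M -> 0 <= a <= 1 ->
  2 * rin (M u) v <= rin (op_pow (op_abs M) (2 * a) u) u +
    rin (op_pow (op_abs (adjoint M)) (2 * (1 - a)) v) v.
Proof.
move=> bM /andP[a0 a1]; have [bA hA] := adjointP bM.
have [_ bE sE pE] := op_abs_facts bM; have [_ bF sF pF] := op_abs_facts bA.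
have ME := op_abs_intertwine bM.
have F2 := op_abs_sq bA; rewrite adjointK // in F2.
set E := op_abs M in bE sE pE ME *; set F := op_abs (adjoint M) in bF sF pF ME F2 *.
have r1 : 0 <= 2 * a by lra.
have r2 : 0 <= 2 * (1 - a) by lra.
have [fG _ _ _] := op_pow_facts bE sE pE r1.
have [fK _ _ pK] := op_pow_facts bF sF pF r2.
set G := op_pow E _ in fG *; set K := op_pow F _ in fK pK *.
have /bounded_opP[lE [b [b0 hb]]] := bE.
have /bounded_opP[lF [b' [b0' hb']]] := bF.
have [lM _] := bM; have [lA _] := bA.
have sp t : spectrum E t%:C -> 0 <= t <= b + b'.
  move=> tE; rewrite (spectrum_ge0 bE) //=.
  by rewrite (le_trans (spectrum_le bE sE hb tE)) // lerDl ltW.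
have sp' t : spectrum F t%:C -> 0 <= t <= b + b'.
  move=> tF; rewrite (spectrum_ge0 bF) //=.
  by rewrite (le_trans (spectrum_le bF sF hb' tF)) // lerDr ltW.
have gh (t : R) : 0 <= t -> t `^ (2 * a) * t `^ (2 * (1 - a)) = t ^+ 2.
  (* The exponents add up to 2, which is nonzero, so the addition law also holds at [t = 0]. *)
  move=> t0; rewrite -powRD; last first.
    by rewrite -mulrDr subrKC mulr1 pnatr_eq0.
  by rewrite -mulrDr subrKC mulr1 -powR_mulrn.
pose Av := adjoint M v.
(* The three terms are the errors in [h2], [h4] and, doubled, [h3]. *)
apply: (@ler_eps_mul1 _ _ _ (3 * nrm u ^+ 2 + 3 * rin (K v) v + 2 * (nrm u * nrm Av))).
  by rewrite !addr_ge0 ?mulr_ge0 ?sqr_ge0 ?nrm_ge0.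
move=> d d01; have /andP[d0 _] := d01.
have [p [q hpq]] := poly_approx_inverse (addr_gt0 b0 b0') d01
   (powR_continuous r1) (fun t _ => powR_ge0 t _) (fun t _ => powR_ge0 t _) gh.
have h1 : 0 <= rin (poly_op p E (u - poly_op q E Av)) (u - poly_op q E Av).
  apply: poly_op_positive => // t /sp tb; have [h _ _ _] := hpq t tb.
  exact: le_trans (powR_ge0 _ _) h.
have h2 : rin (poly_op p E u) u <= rin (G u) u + 3 * d * nrm u ^+ 2.
  have := fun_calc_ge_poly bE sE fG (p := p - (3 * d)%:P) _ u.
  rewrite poly_opB poly_opC !rinE rin_sq => h; rewrite -lerBlDr.
  by apply: h => t /sp tb; rewrite !hornerE; have [_ h _ _] := hpq t tb; lra.
(* On the spectrum [q p] is within [d] of 1, so moving [q(E)] to the left almost recovers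
   [<u, Av> = <M u, v>]. *)
have h3 : `|rin (M u) v - rin (poly_op p E u) (poly_op q E Av)| <=
    d * (nrm u * nrm Av).
  rewrite -(poly_op_selfadj q lE sE) -poly_opM // hA -/Av -rinNl -rinDl.
  apply: le_trans (rin_cauchy _ _) _; rewrite mulrA ler_wpM2r ?nrm_ge0 //.
  have -> : u - poly_op (q * p) E u = poly_op (1%:P - q * p) E u.
    by rewrite poly_opB poly_opC scale1r.
  apply: (poly_op_norm bE sE (ltW d0)) => t /sp tb.
  by rewrite !hornerE mulrC; have [_ _ h _] := hpq t tb.
(* Moving [M] across turns polynomials of [E] into polynomials of [F], and
   [M (adjoint M v) = F (F v)] supplies the factor [t^2] in the last bound of
   [poly_approx_inverse]. *)
have h4 : rin (poly_op p E (poly_op q E Av)) (poly_op q E Av) <=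
    (1 + 3 * d) * rin (K v) v.
  rewrite -(poly_op_selfadj q lE sE) -!poly_opM // /Av -hA.
  rewrite (poly_op_intertwine _ lM ME) -F2.
  have -> r : poly_op r F (F (F v)) = poly_op (r * ('X * 'X)) F v.
    by rewrite !poly_opM // !poly_opX.
  have c0 : 0 < 1 + 3 * d by lra.
  rewrite -ler_pdivrMl //.
  have := fun_calc_ge_poly bF sF fK
     (p := (1 + 3 * d)^-1 *: (q * p * q * ('X * 'X))) _ v.
  rewrite poly_opZ rinZl; apply => t /sp' tb.
  rewrite hornerZ ler_pdivrMl // !hornerM !hornerX; have [_ _ _ h] := hpq t tb.
  by rewrite [leLHS](_ : _ = p.[t] * q.[t] ^+ 2 * t ^+ 2) //; ring.
have [lp _] := poly_op_bounded p bE.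
rewrite (linB lp) !rinE in h1.
have sw : rin (poly_op p E (poly_op q E Av)) u = rin (poly_op p E u) (poly_op q E Av).
  by rewrite (poly_op_selfadj p lE sE) rinC.
rewrite sw in h1.
move: h3; rewrite ler_norml => /andP[_ h3].
lra.
Qed.

Lemma rin_unit z u v : normc z = 1 ->
  rin (z *: u) (z *: v) = rin u v.
Proof.
move=> z1; rewrite /rin linearZl_LR linearZr_LR /= mulrA.
suff -> : z * conjc z = 1 by rewrite mul1r.
by rewrite -sqr_normc normr_normc z1 -rmorphXn expr1n.
Qed.

(** The phase of the inner product is absorbed into [u], which leaves the quadratic form on the
    right unchanged. *)
Lemma mixed_schwarz M (a : R) u v : bounded_op M -> 0 <= a <= 1 ->
  2 * normc (inner H (M u) v) <=
    rin (op_pow (op_abs M) (2 * a) u) u +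
    rin (op_pow (op_abs (adjoint M)) (2 * (1 - a)) v) v.
Proof.
move=> bM a01; have [lM _] := bM.
have [z [z1 ->]] := inner_phase (M u) v.
rewrite -linZ //; apply: le_trans (mixed_schwarz_real _ _ bM a01) _.
have [_ bE sE pE] := op_abs_facts bM.
have [|_ [lG _] _ _] := op_pow_facts bE sE pE (r := 2 * a).
  by case/andP: a01 => ? ?; lra.
by rewrite (linZ lG) rin_unit.
Qed.

End AbsoluteValue.

(** * Jensen's inequality and Berezin bounds *)

Section ConvexFunctions.
Variables (R : realType) (f : R -> R).
Hypothesis orl : orlicz f.

Lemma orlicz_conv l x y : 0 <= l <= 1 -> 0 <= x -> 0 <= y ->
  f (l * x + (1 - l) * y) <= l * f x + (1 - l) * f y.
Proof.
move=> /andP[l0 l1] x0 y0.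
have := @orlicz_convex _ _ orl (Itv01 l0 l1) x y.
by rewrite !inE /= !in_itv /= !andbT !convRE /=; apply.
Qed.

(** For [s > 0] the slope is the supremum of the difference quotients to the left of [s]; convexity
    puts each of them below every quotient to the right. At [s = 0] slope 0 works. *)
Lemma orlicz_supporting_line s : 0 <= s ->
  exists c, forall t, 0 <= t -> f s + c * (t - s) <= f t.
Proof.
rewrite le_eqVlt => /predU1P[<-|s0].
  by exists 0 => t t0; rewrite (orlicz_at0 orl) mul0r addr0 (orlicz_ge0 orl).
have slope x y : 0 <= x -> x < s -> s < y ->
    (f s - f x) / (s - x) <= (f y - f s) / (y - s).
  move=> x0 xs sy.
  have sx0 : 0 < s - x by lra.
  have ys0 : 0 < y - s by lra.
  have yx0 : 0 < y - x by lra.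
  rewrite ler_pdivrMr // mulrAC ler_pdivlMr //.
  have := @orlicz_conv ((y - s) / (y - x)) x y _ x0 (ltW (lt_trans s0 sy)).
  have -> : (y - s) / (y - x) * x + (1 - (y - s) / (y - x)) * y = s.
    by field; rewrite gt_eqF.
  have -> : (y - s) / (y - x) * f x + (1 - (y - s) / (y - x)) * f y =
      ((y - s) * f x + (s - x) * f y) / (y - x) by field; rewrite gt_eqF.
  move=> h; have {h} : f s <= ((y - s) * f x + (s - x) * f y) / (y - x).
    by apply: h; rewrite divr_ge0 ?(ltW ys0) ?(ltW yx0) //= ler_pdivrMr //; lra.
  rewrite ler_pdivlMr //; lra.
pose E := [set (f s - f x) / (s - x) | x in [set x | 0 <= x < s]].
have Eub y : s < y -> ubound E ((f y - f s) / (y - s)).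
  by move=> sy _ [x /andP[x0 xs] <-]; exact: slope.
have supE : has_sup E.
  split; first by exists ((f s - f 0) / (s - 0)), 0 => //=; rewrite lexx.
  by exists ((f (s + 1) - f s) / (s + 1 - s)); apply: Eub; lra.
exists (sup E) => t t0; have [ts|ts|->] := ltgtP t s.
- have : (f s - f t) / (s - t) <= sup E.
    by apply: (ub_le_sup supE.2); exists t => //=; rewrite t0.
  rewrite ler_pdivrMr; lra.
- have : sup E <= (f t - f s) / (t - s) by apply: ge_sup (Eub _ ts); case: supE.
  rewrite ler_pdivlMr; lra.
- by rewrite subrr mulr0 addr0.
Qed.

(** By continuity, [f (sup S) > c] would force [f s > c] at some [s] in [S] close to the
    supremum. *)
Lemma orlicz_sup_le (S : set R) c : has_sup S -> (forall s, S s -> 0 <= s) ->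
  (forall s, S s -> f s <= c) -> f (sup S) <= c.
Proof.
move=> supS S0 fS; rewrite leNgt; apply/negP => cf.
have [s0 Ss0] := supS.1.
have m0 : 0 <= sup S := le_trans (S0 _ Ss0) (ub_le_sup supS.2 Ss0).
have := orlicz_continuous orl; move/subspace_continuousP => /(_ (sup S)).
rewrite /= in_itv /= m0 => /(_ isT) /cvgrPdist_lt.
have e0 : 0 < f (sup S) - c by lra.
move=> /(_ _ e0); rewrite near_withinE => -[r /= r0 hr].
have [s Ss rs] := sup_adherent r0 supS.
have sm := ub_le_sup supS.2 Ss.
have : `|f (sup S) - f s| < f (sup S) - c.
  apply: hr => /=; last by rewrite in_itv /= S0.
  by rewrite ger0_norm; lra.
by have := fS _ Ss; rewrite ltr_norml; lra.
Qed.

End ConvexFunctions.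

(** * Jensen's inequality for operators and estimates of the Berezin number *)

Section BerezinBounds.
Local Open Scope complex_scope.
Variables (R : realType) (X : Type) (H : rkhs R X).
Hypotheses (X_neq0 : [set: X] !=set0).
Hypothesis kernel_neq0 : forall x : X, rep_kernel H x != 0.
Implicit Types (T A B M : H -> H) (u v w : H).

Lemma orlicz_jensen T f u : bounded_op T -> selfadj T ->
  (forall v, 0 <= rin (T v) v) -> orlicz f -> nrm u = 1 ->
  f (rin (T u) u) <= rin (fun_calc f T u) u.
Proof.
move=> bT sT pT orl u1.
have fc := fun_calc_exists bT sT pT (orlicz_continuous orl).
set s := rin (T u) u; have [c hc] := orlicz_supporting_line orl (pT u).
(* The supporting line at [s = <T u, u>] as a polynomial; as [|u| = 1], its form at [u] is exactly
   [f s]. *)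
have := fun_calc_ge_poly bT sT fc (p := (f s)%:P + c *: ('X - s%:P)) _ u.
rewrite poly_opD poly_opZ poly_opB !poly_opC poly_opX !rinE rin_sq u1 expr1n.
rewrite -/s !mulr1 subrr mulr0 addr0; apply => t tT.
by rewrite !hornerE; apply: hc; exact: (spectrum_ge0 bT).
Qed.

Lemma Re_le_normc (z : R[i]) : complex.Re z <= normc z.
Proof.
have := normc_ge_Re z; rewrite normr_normc lecR; apply: le_trans; exact: ler_norm.
Qed.

Lemma nrm_normalized_rk x : nrm (normalized_rk H x) = 1.
Proof.
have k0 : `|rep_kernel H x| != 0 by rewrite normr_eq0.
by rewrite /nrm /normalized_rk normrZ normfV normr_id mulVf.
Qed.

Lemma congruence_facts A (S : H -> H) : bounded_op A -> bounded_op S ->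
  selfadj S -> (forall u, 0 <= rin (S u) u) ->
  [/\ bounded_op (adjoint A \o S \o A), selfadj (adjoint A \o S \o A),
      (forall u, 0 <= rin ((adjoint A \o S \o A) u) u) &
      forall u, rin ((adjoint A \o S \o A) u) u = rin (S (A u)) (A u)].
Proof.
move=> bA bS sS pS; have [bA' hA] := adjointP bA.
have hA' u v : rin (adjoint A u) v = rin u (A v) by rewrite rinC -hA rinC.
split.
- by apply: bounded_op_comp => //; exact: bounded_op_comp.
- by move=> u v /=; rewrite hA' -hA sS.
- by move=> u /=; rewrite hA'.
- by move=> u /=; rewrite hA'.
Qed.

Lemma normc_inner_unit_le T : bounded_op T -> exists c, forall u v,
  nrm u = 1 -> nrm v = 1 -> normc (inner H (T u) v) <= c.
Proof.
move=> /bounded_opP[_ [c [c0 hc]]]; exists c => u v u1 v1.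
apply: le_trans (normc_inner _ _) _; rewrite v1 mulr1.
by have := hc u; rewrite u1 mulr1.
Qed.

(** Ensures that the [sup] in [berezin_number] is a true least upper bound: normalized kernels are
    unit vectors, so the values are bounded. *)
Lemma berezin_number_has_sup T : bounded_op T ->
  has_sup (range (fun x => normc (inner H (T (normalized_rk H x)) (normalized_rk H x)))).
Proof.
move=> /normc_inner_unit_le[c hc]; have [x _] := X_neq0.
split; first by eexists; exists x.
by exists c => _ [y _ <-]; apply: hc; exact: nrm_normalized_rk.
Qed.

Lemma berezin_number_ge0 T : bounded_op T -> 0 <= berezin_number T.
Proof.
move=> bT; have [x _] := X_neq0; have sT := berezin_number_has_sup bT.
apply: le_trans (ub_le_sup sT.2 _); last by exists x.
exact: normc_ge0.
Qed.

Lemma berezin_norm_ge T x y : bounded_op T ->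
  normc (inner H (T (normalized_rk H x)) (normalized_rk H y)) <= berezin_norm T.
Proof.
move=> /normc_inner_unit_le[c hc]; apply: ub_le_sup; last by exists (x, y).
by exists c => _ [xy _ <-]; apply: hc; exact: nrm_normalized_rk.
Qed.

(** The weights are written in the shape that [orlicz_conv] takes at [l = 2^-1]. *)
Lemma berezin_number_midpoint T S : bounded_op T -> bounded_op S ->
  berezin_number (2^-1 *: (T + S)) <=
    2^-1 * berezin_number T + (1 - 2^-1) * berezin_number S.
Proof.
move=> bT bS; have sT := berezin_number_has_sup bT.
have sS := berezin_number_has_sup bS; have [x0 _] := X_neq0.
apply: ge_sup; first by eexists; exists x0.
move=> _ [x _ <-]; set k := normalized_rk H x.
have hT : normc (inner H (T k) k) <= berezin_number T.
  by apply: (ub_le_sup sT.2); exists x.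
have hS : normc (inner H (S k) k) <= berezin_number S.
  by apply: (ub_le_sup sS.2); exists x.
have -> : inner H ((2^-1 *: (T + S)) k) k =
    (2^-1 : R)%:C * (inner H (T k) k + inner H (S k) k).
  by rewrite /= linearZl_LR linearDl fmorphV rmorph_nat.
have := normcM ((2^-1 : R)%:C) (inner H (T k) k + inner H (S k) k).
move=> ->; rewrite normcR ger0_norm ?invr_ge0 //.
have := le_normcD (inner H (T k) k) (inner H (S k) k); lra.
Qed.

(** At each kernel [k]: monotonicity and convexity of [f], then Jensen for [T1] and [T2], then the
    diagonal entry of the Berezin norm. [orlicz_sup_le] passes to the supremum. *)
Lemma orlicz_berezin_number_le_norm T T1 T2 f : bounded_op T ->
  bounded_op T1 -> selfadj T1 -> (forall u, 0 <= rin (T1 u) u) ->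
  bounded_op T2 -> selfadj T2 -> (forall u, 0 <= rin (T2 u) u) -> orlicz f ->
  (forall u, 2 * normc (inner H (T u) u) <= rin (T1 u) u + rin (T2 u) u) ->
  f (berezin_number T) <= 2^-1 * berezin_norm (fun_calc f T1 + fun_calc f T2).
Proof.
move=> bT b1 s1 p1 b2 s2 p2 orl ms.
have bN : bounded_op (fun_calc f T1 + fun_calc f T2).
  apply: (bounded_op_add (T := fun_calc f T1) (S := fun_calc f T2)).
    exact: (fun_calc_bounded b1 (fun_calc_exists b1 s1 p1 (orlicz_continuous orl))).
  exact: (fun_calc_bounded b2 (fun_calc_exists b2 s2 p2 (orlicz_continuous orl))).
apply: (orlicz_sup_le orl (berezin_number_has_sup bT)).
  by move=> _ [x _ <-]; exact: normc_ge0.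
move=> _ [x _ <-]; set k := normalized_rk H x.
have k1 : nrm k = 1 by exact: nrm_normalized_rk.
apply: (@le_trans _ _ (f (2^-1 * rin (T1 k) k + (1 - 2^-1) * rin (T2 k) k))).
  apply: (orlicz_nondecreasing orl); first exact: normc_ge0.
  have := ms k; lra.
apply: le_trans (orlicz_conv orl _ (p1 k) (p2 k)) _.
  by rewrite invr_ge0 ler0n invf_le1 ?ler1n ?ltr0n.
have j1 := orlicz_jensen b1 s1 p1 orl k1.
have j2 := orlicz_jensen b2 s2 p2 orl k1.
have := berezin_norm_ge x x bN; rewrite -/k.
have := Re_le_normc (inner H ((fun_calc f T1 + fun_calc f T2) k) k).
rewrite -/(rin _ k) rinDl; lra.
Qed.

Lemma orlicz_berezin_number_le A B M f (a : R) :
  bounded_op A -> bounded_op B -> bounded_op M -> orlicz f -> 0 <= a <= 1 ->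
  f (berezin_number (adjoint A \o M \o B)) <=
    2^-1 * berezin_norm
      (fun_calc f (adjoint B \o op_pow (op_abs M) (2 * a) \o B) +
       fun_calc f (adjoint A \o op_pow (op_abs (adjoint M)) (2 * (1 - a)) \o A)).
Proof.
move=> bA bB bM orl a01; have [bA' hA] := adjointP bA.
have [bM' _] := adjointP bM.
have [_ bE sE pE] := op_abs_facts bM; have [_ bF sF pF] := op_abs_facts bM'.
have /andP[a0 a1] := a01.
have r1 : 0 <= 2 * a by lra.
have r2 : 0 <= 2 * (1 - a) by lra.
have [_ bG sG pG] := op_pow_facts bE sE pE r1.
have [_ bK sK pK] := op_pow_facts bF sF pF r2.
have [b1 s1 p1 e1] := congruence_facts bB bG sG pG.
have [b2 s2 p2 e2] := congruence_facts bA bK sK pK.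
apply: orlicz_berezin_number_le_norm => //.
  by apply: bounded_op_comp => //; exact: bounded_op_comp.
move=> u; rewrite e1 e2.
have -> : inner H ((adjoint A \o M \o B) u) u = inner H (M (B u)) (A u).
  apply: (rin_inner (T := adjoint A) (S := A)); [by case: bA'|by case: bA|].
  by move=> v w; rewrite rinC -hA rinC.
exact: mixed_schwarz.
Qed.

End BerezinBounds.

Lemma path_ge_left (R : realType) (s : R -> R -> R) (st : R -> R -> R -> R) t a b :
  interpolational_path s st -> 0 <= t <= 1 -> 0 <= a -> a <= b -> a <= st t a b.
Proof.
move=> p t01 a0 ab; have := mean_between (path_mean p t01) a0 ab.
by case/andP.
Qed.

Unset Implicit Arguments.
Set Strict Implicit.
Set Printing Implicit Defensive.

Theorem theorem3p7 (R : realType) (X : Type) (X_neq0 : [set: X] !=set0)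
    (H : rkhs R X) (kernel_neq0 : forall x : X, rep_kernel H x != 0)
    (A B C D M N : H -> H)
    (bA : bounded_op A) (bB : bounded_op B) (bC : bounded_op C)
    (bD : bounded_op D) (bM : bounded_op M) (bN : bounded_op N)
    (sigma tau : R -> R -> R)
    (ssigma : symmetric_mean sigma) (stau : symmetric_mean tau)
    (sigma_ tau_ : R -> R -> R -> R)
    (psigma : interpolational_path sigma sigma_)
    (ptau : interpolational_path tau tau_)
    (mu nu : R) (mu01 : 0 <= mu <= 1) (nu01 : 0 <= nu <= 1)
    (f : R -> R) (orl_f : orlicz f) (mul_f : multiplicative_fun f)
    (alpha beta : R) (alpha01 : 0 <= alpha <= 1) (beta01 : 0 <= beta <= 1) :
  f (berezin_number
       (2^-1 *: ((adjoint A \o M \o B) + (adjoint C \o N \o D)))) <=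
  2^-1 * sigma_ mu
    (f (berezin_number (adjoint A \o M \o B)))
    (2^-1 * berezin_norm
       (fun_calc f (adjoint B \o op_pow (op_abs M) (2 * alpha) \o B) +
        fun_calc f (adjoint A \o op_pow (op_abs (adjoint M)) (2 * (1 - alpha))
                      \o A))) +
  2^-1 * tau_ nu
    (f (berezin_number (adjoint C \o N \o D)))
    (2^-1 * berezin_norm
       (fun_calc f (adjoint D \o op_pow (op_abs N) (2 * beta) \o D) +
        fun_calc f (adjoint C \o op_pow (op_abs (adjoint N)) (2 * (1 - beta))
                      \o C))).
Proof.
have bT : bounded_op (adjoint A \o M \o B).
  by apply: bounded_op_comp bB; apply: bounded_op_comp bM; have [] := adjointP bA.
have bS : bounded_op (adjoint C \o N \o D).
  by apply: bounded_op_comp bD; apply: bounded_op_comp bN; have [] := adjointP bC.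
have T0 := berezin_number_ge0 X_neq0 kernel_neq0 bT.
have S0 := berezin_number_ge0 X_neq0 kernel_neq0 bS.
have half : 0 <= (2^-1 : R) <= 1.
  by rewrite invr_ge0 ler0n invf_le1 ?ler1n ?ltr0n.
have h := berezin_number_midpoint X_neq0 kernel_neq0 bT bS.
have h0 : 0 <= berezin_number
    (2^-1 *: ((adjoint A \o M \o B) + (adjoint C \o N \o D))).
  apply: (berezin_number_ge0 X_neq0 kernel_neq0).
  by have := bounded_op_scale (2^-1 : R[i]) (bounded_op_add bT bS).
apply: le_trans (orlicz_nondecreasing orl_f h0 h) _.
apply: le_trans (orlicz_conv orl_f half T0 S0) _.
rewrite [X in _ + X * _ <= _](_ : _ = 2^-1); last by field.
(* In each summand the first argument of the mean is at most the second, by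
   [orlicz_berezin_number_le], so the mean is at least the first. *)
apply: lerD; rewrite ler_pM2l ?invr_gt0 //.
  apply: (path_ge_left psigma mu01); first exact: (orlicz_ge0 orl_f).
  exact: orlicz_berezin_number_le.
apply: (path_ge_left ptau nu01); first exact: (orlicz_ge0 orl_f).
exact: orlicz_berezin_number_le.
Qed.
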